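(* Let $\mathcal F_m(M)$ be a one-parameter exponential family with mean parameters in $(0,M]$, whose log-partition function $b$ is twice differentiable with continuous second derivative $b''>0$ on $\Theta$, and whose variance function $V$ satisfies, for some $C_L>0$, $|V(\mu)-V(\mu')|\le C_L|\mu-\mu'|$ for all $\mu,\mu'\in(0,M]$. Then there is a constant $C>0$, depending only on $C_L$ and $M$, such that for every $K\ge2$, every $T\ge2$, and every $K$-armed bandit problem whose reward distributions all belong to the (known) family $\mathcal F_m(M)$, the algorithm General-Exp-KL-MS with $L(k)=k$ satisfies $$\mathrm{Reg}(T)\le C\sqrt{V(\mu_{\max})\,K\,T\ln T}+C\,K\ln T.$$
   Context: Exponential family: given a base measure $m$ on $\mathbb R$, $\{p_\theta(dx)=m(dx)\exp(x\theta-b(\theta)):\theta\in\Theta\}$, where $\Theta\subset\mathbb R$ is an interval and $b(\theta)=\ln\int_{\mathbb R}e^{x\theta}m(dx)$. Members are determined by their mean $b'(\theta)$. The variance function $V(\mu)$ is the variance of the member with mean $\mu$. $\mathrm{KL}(\mu,\mu')$ denotes the Kullback–Leibler divergence $\mathbb E_{X\sim\nu}[\ln\frac{d\nu}{d\nu'}(X)]$ between the members $\nu,\nu'$ with means $\mu,\mu'$. Bandit: each arm $a\in[K]=\{1,\dots,K\}$ has reward distribution $\nu_a$ in the family with mean $\mu_a$; $\mu_{\max}=\max_a\mu_a$. In round $t=1,\dots,T$ the agent picks $I_t\in[K]$ (based on the past and internal randomness) and receives $r_t\sim\nu_{I_t}$, independent of the past given $I_t$. $N_{t,a}=\sum_{i\le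 t}\mathbf 1\{I_i=a\}$, $\hat\mu_{t,a}=\frac1{N_{t,a}}\sum_{i\le t}r_i\mathbf 1\{I_i=a\}$, $\hat\mu_{t,\max}=\max_a\hat\mu_{t,a}$. It is assumed that empirical means are means of members of the exponential family. Regret: $\mathrm{Reg}(T)=\mathbb E\big[\sum_{t=1}^T(\mu_{\max}-\mu_{I_t})\big]$. General-Exp-KL-MS with inverse temperature function $L$: in rounds $t\le K$ pull $I_t=t$; in each round $t>K$ pull $I_t=a$ with probability $p_{t,a}=\exp\!\big(-L(N_{t-1,a})\,\mathrm{KL}(\hat\mu_{t-1,a},\hat\mu_{t-1,\max})\big)/M_t$, where $M_t$ normalizes the probabilities to sum to $1$. *)

(* Defs.v *)
From HB Require Import structures.
From mathcomp Require Import all_boot all_order all_algebra.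
From mathcomp Require Import all_classical all_reals all_analysis.

Set Implicit Arguments.
Unset Strict Implicit.
Unset Printing Implicit Defensive.

Import Order.TTheory GRing.Theory Num.Theory.
Import numFieldNormedType.Exports.

Local Open Scope classical_set_scope.
Local Open Scope ring_scope.
Local Open Scope charge_scope.

(* l is the derivative of f at x along D; it is one-sided when x is an endpoint
   of the interval D that belongs to D. *)
Definition derivative_in (R : realType) (D : set R) (f : R -> R) (x l : R) :=
  (fun y => (f y - f x) / (y - x)) @ within D (dnbhs x) --> l.

Definition C2_in_with_pos_second_derivative (R : realType) (D : set R)
    (f : R -> R) :=
  exists f1 f2 : R -> R,
    [/\ forall x, D x -> derivative_in D f x (f1 x),
        forall x, D x -> derivative_in D f1 x (f2 x),
        {within D, continuous f2} &
        forall x, D x -> 0 < f2 x].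

Section probabilities_on_the_line.
Variable R : realType.
Implicit Types nu : probability R R.

Definition mean nu : R := fine 'E_nu[fun x : R => x].

Definition var nu : R := fine 'V_nu[fun x : R => x].

Definition KL_divergence nu nu' : \bar R :=
  (\int[nu]_x lne (('d (charge_of_finite_measure nu) '/d nu') x))%E.

End probabilities_on_the_line.

Section exponential_family.
Variables (R : realType) (m : {measure set R -> \bar R}) (Theta : interval R).

Definition partition_function (theta : R) : \bar R :=
  (\int[m]_x (expR (x * theta))%:E)%E.

Definition log_partition (theta : R) : R := ln (fine (partition_function theta)).

Definition exp_family : set (probability R R) :=
  [set nu | exists2 theta, theta \in Theta &
    forall A : set R, measurable A ->
      nu A = (\int[m]_(x in A) (expR (x * theta - log_partition theta))%:E)%E].

Definition exp_family_upto (M : R) : set (probability R R) :=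
  [set nu | exp_family nu /\ 0 < mean nu <= M].

Definition mean_space : set R := @mean R @` exp_family.

(* Meaningful for mu in mean_space only; elsewhere it is an arbitrary
   probability, and so are the values of the two functions that follow. *)
Definition member_of_mean (mu : R) : probability R R :=
  get [set nu | exp_family nu /\ mean nu = mu].

Definition variance_function (mu : R) : R := var (member_of_mean mu).

Definition KL_of_means (mu mu' : R) : R :=
  fine (KL_divergence (member_of_mean mu) (member_of_mean mu')).

End exponential_family.

Definition max_over (R : realType) (K : nat) (f : 'I_K -> R) : R :=
  sup (range f).

(* Rounds are numbered from 1, and the a-th arm is the ordinal a - 1; the values
   I 0 and r 0 of the processes are never used. *)
Section bandit.
Variables (R : realType) (d : measure_display) (Omega : measurableType d).
Variables (P : probability Omega R) (K : nat).
Variables (I : nat -> Omega -> 'I_K) (r : nat -> Omega -> R).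

Definition pulls (t : nat) (a : 'I_K) (w : Omega) : nat :=
  (\sum_(1 <= i < t.+1) (I i w == a))%N.

Definition emp_mean (t : nat) (a : 'I_K) (w : Omega) : R :=
  (\sum_(1 <= i < t.+1 | I i w == a) r i w) / (pulls t a w)%:R.

Definition emp_max (t : nat) (w : Omega) : R :=
  max_over (fun a => emp_mean t a w).

(* The sigma-algebra generated by (I_1, r_1, ..., I_t, r_t) *)
Definition history (t : nat) : set (set Omega) :=
  <<s [set A | exists2 i, (1 <= i <= t)%N &
         (exists a, A = I i @^-1` [set a]) \/
         (exists2 B : set R, measurable B & A = r i @^-1` B)] >>.

(* (I_t, r_t), 1 <= t <= T, is an interaction with arms nu of an agent whose
   conditional probability of playing a in round t given the history is
   policy t a.  The integral below is the defining equation of that conditional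
   probability. *)
Record bandit_interaction (T : nat) (nu : 'I_K -> probability R R)
    (policy : nat -> 'I_K -> Omega -> R) : Prop := BanditInteraction {
  measurable_choice : forall t a, (1 <= t <= T)%N ->
    measurable (I t @^-1` [set a]) ;
  measurable_reward : forall t, (1 <= t <= T)%N -> measurable_fun setT (r t) ;
  choice_law : forall t a A, (1 <= t <= T)%N -> history t.-1 A ->
    P (A `&` I t @^-1` [set a]) = (\int[P]_(w in A) (policy t a w)%:E)%E ;
  reward_law : forall t a A (B : set R), (1 <= t <= T)%N ->
    history t.-1 A -> measurable B ->
    P (A `&` I t @^-1` [set a] `&` r t @^-1` B) =
      (P (A `&` I t @^-1` [set a]) * nu a B)%E
}.

Definition regret (T : nat) (nu : 'I_K -> probability R R) : \bar R :=
  'E_P[fun w => \sum_(1 <= t < T.+1)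
                  (max_over (fun a => mean (nu a)) - mean (nu (I t w)))].

Section general_exp_KL_MS.
Variables (m : {measure set R -> \bar R}) (Theta : interval R) (L : nat -> R).

Definition KL_MS_weight (t : nat) (a : 'I_K) (w : Omega) : R :=
  expR (- (L (pulls t.-1 a w) *
           KL_of_means m Theta (emp_mean t.-1 a w) (emp_max t.-1 w))).

(* In a round t <= K, arm t is played with probability 1. *)
Definition KL_MS_policy (t : nat) (a : 'I_K) (w : Omega) : R :=
  if (t <= K)%N then (a.+1 == t)%:R
  else KL_MS_weight t a w / \sum_(c < K) KL_MS_weight t c w.

End general_exp_KL_MS.

Definition emp_means_in (T : nat) (J : set R) : Prop :=
  forall t a, (1 <= t <= T)%N ->
    {ae P, forall w, (0 < pulls t a w)%N -> J (emp_mean t a w)}.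

End bandit.

(* Main.v *)
(** Write D(s,t) = b t - b s - (t - s) b'(s); the divergence between two members is
    D at their natural parameters, and exponential tilting gives the Chernoff bound
    exp(-k D) for the mean of k rewards.  If V <= v between the two means, then their
    squared distance is at most 4 v D.

    Fix a suboptimal arm a with gap g, an optimal arm o, and the thresholds mu_a + g/4
    and mu_max - g/4.  A round in which a is played falls into one of these cases:
    a has few pulls; a is over-estimated (sum Chernoff bounds over the number of pulls);
    a is well estimated and so is the best empirical mean, so that a is played with
    probability at most exp(-u D) <= 1/T; or every arm looks worse than mu_max - g/4.
    In the last case a is played with probability at most exp(N_o D(o^, max^)) times
    that of o, where N_o is the number of pulls of o, and o^, max^ stand for the
    empirical mean of o and the largest one.  Peeling over the integer part j of
    N_o D(o^, o) trades a factor exp(j+1) for a deviation event of probability exp(-j),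
    while superadditivity of D leaves exp(-N_o D(mu_max - g/4, mu_max)), which is
    summable over N_o.

    All divergences that are bounded below are between means of [mu_a, mu_max], where
    V <= V(mu_max) + C_L g, so that g E[N_a] = O((V(mu_max) / g + C_L + M) ln T) even
    though empirical means may leave (0, M].  Arms of gap below
    sqrt(V(mu_max) K ln T / T) are charged that gap per pull instead. *)
Require Import Defs.
From HB Require Import structures.
From mathcomp Require Import all_boot all_order all_algebra.
From mathcomp Require Import all_classical all_reals all_analysis.
From mathcomp Require Import measurable_realfun.
From mathcomp Require Import ring lra.

Set Implicit Arguments.
Unset Strict Implicit.
Unset Printing Implicit Defensive.

Import Order.TTheory GRing.Theory Num.Theory.
Import numFieldNormedType.Exports.

Local Open Scope classical_set_scope.
Local Open Scope ring_scope.
Local Open Scope charge_scope.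

(** * Integration *)

Section integrals_of_arbitrary_functions.
Context d (T : measurableType d) (R : realType) (mu : {measure set T -> \bar R}).
Local Open Scope ereal_scope.
Import HBNNSimple.

(* Measurability of f and g is deliberately not assumed: the sampling probabilities
   of the policy are integrated although they are not known to be measurable. *)
Lemma ae_ge0_le_integralZ (D : set T) (c : R) (f g : T -> \bar R) :
  (0 < c)%R -> (forall x, D x -> 0 <= f x) -> (forall x, D x -> 0 <= g x) ->
  {ae mu, forall x, D x -> f x <= c%:E * g x} ->
  \int[mu]_(x in D) f x <= c%:E * \int[mu]_(x in D) g x.
Proof.
move=> c0 f0 g0 [N [mN N0 subN]].
rewrite ge0_integralE//; apply: ge_ereal_sup => _ [/= h hf <-].
have cV0 : (0 <= c^-1)%R by rewrite invr_ge0 ltW.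
(* Integrals of nonnegative functions are suprema over simple functions below them. Dividing [h] by
   [c] and killing it on the null set [N] gives a simple function below [g], with the same integral
   up to the factor [c]. *)
pose k := mul_nnsfun (scale_nnsfun h cV0) (indic_nnsfun R (measurableC mN)).
have mE (l : {nnsfun T >-> R}) : measurable_fun setT (fun x => (l x)%:E).
  by apply/measurable_EFinP.
have kE x : k x = (c^-1 * h x * \1_(~` N) x)%R by [].
have -> : sintegral mu h = c%:E * sintegral mu k.
  rewrite -!integralT_nnsfun -ge0_integralZl_EFin//; last exact: ltW.
  apply: ge0_ae_eq_integral => //.
  - exact: measurable_funeM.
  - by move=> x _; rewrite lee_fin.
  - by move=> x _; rewrite mule_ge0// lee_fin// ltW.
  - exists N; split => // x hkx; apply: contrapT => Nx; apply: hkx => _.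
    rewrite -[RHS]/(c%:E * (k x)%:E) kE indicE mem_set//= mulr1 -EFinM mulrA.
    by rewrite mulfV ?gt_eqF// mul1r.
  - by move=> x _; rewrite lee_fin.
rewrite lee_pmul2l ?lte_fin//.
rewrite ge0_integralE//; apply: ereal_sup_ubound; exists k => // x.
rewrite -[X in X <= _]/((k x)%:E) kE indicE; have [Nx|Nx] := pselect (N x).
  by rewrite memNset ?mulr0 ?erestrict_ge0// => /(_ Nx).
rewrite mem_set//= mulr1.
have := hf x; rewrite /patch; case: ifPn => [/[!inE] Dx hfx|_ hx0]; last first.
  have -> : h x = 0%R by apply/eqP; rewrite eq_le -lee_fin hx0/= fun_ge0.
  by rewrite mulr0.
have fg : f x <= c%:E * g x.
  by apply: contrapT => H; apply: Nx; apply: subN => /(_ Dx).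
have := le_trans hfx fg.
rewrite -[in X in _ -> X](@lee_pmul2l _ c%:E) ?lte_fin// -EFinM mulrA mulfV ?gt_eqF//.
by rewrite mul1r.
Qed.

Lemma ae_eq_ge0_integral (D : set T) (f g : T -> \bar R) :
  (forall x, D x -> 0 <= f x) -> (forall x, D x -> 0 <= g x) ->
  ae_eq mu D f g -> \int[mu]_(x in D) f x = \int[mu]_(x in D) g x.
Proof.
move=> f0 g0 fg; apply: le_anti; apply/andP; split.
- rewrite -[leRHS]mul1e; apply: ae_ge0_le_integralZ => //.
  by apply: filterS fg => x fgx /fgx ->; rewrite mul1e.
- rewrite -[leRHS]mul1e; apply: ae_ge0_le_integralZ => //.
  by apply: filterS fg => x fgx /fgx ->; rewrite mul1e.
Qed.

Lemma ae_eq_integral_total (D : set T) (f g : T -> \bar R) :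
  ae_eq mu D f g -> \int[mu]_(x in D) f x = \int[mu]_(x in D) g x.
Proof.
move=> fg; rewrite integralE [RHS]integralE.
by congr (_ - _); apply: ae_eq_ge0_integral => //; apply: filterS fg => x fgx /fgx;
  rewrite ?unlock => ->.
Qed.

Lemma integral_cst_probability (P : probability T R) (c : R) :
  \int[P]_x c%:E = c%:E.
Proof. by rewrite integral_cst//= (probability_setT P) mule1. Qed.

Lemma exists_probability_of_density (g : T -> R) :
  measurable_fun setT g -> (forall x, 0 <= g x)%R -> \int[mu]_x (g x)%:E = 1 ->
  exists P : probability T R,
    forall A, measurable A -> P A = \int[mu]_(x in A) (g x)%:E.
Proof.
move=> mg g0 g1; pose p A := \int[mu]_(x in A) (g x)%:E.
have p0 : p set0 = 0 by rewrite /p integral_set0.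
have p_ge0 A : 0 <= p A by apply: integral_ge0 => x _; rewrite lee_fin.
have p_add : semi_sigma_additive p.
  move=> F mF tF mUF; apply: cvg_toP.
    apply: ereal_nondecreasing_is_cvgn => m n mn.
    by apply: lee_sum_nneg_natr => // k _ _; exact: p_ge0.
  rewrite /p ge0_integral_bigcup//=.
  - exact/measurable_EFinP/measurable_funTS.
  - by move=> x _; rewrite lee_fin.
pose pm := isMeasure.Build _ _ _ p p0 p_ge0 p_add.
pose pM : {measure set T -> \bar R} := HB.pack p pm.
pose pp := @Measure_isProbability.Build _ _ R pM g1.
pose P : probability T R := HB.pack_for (probability T R) (Measure.sort pM) pp.
by exists P.
Qed.

End integrals_of_arbitrary_functions.

(** * Change of variables for the image under [phi] of a measure with density [g] *)

Section integral_wrt_density.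
Context d1 d2 (T1 : measurableType d1) (T2 : measurableType d2) (R : realType).
Variables (mu : {measure set T1 -> \bar R}) (nu : {measure set T2 -> \bar R}).
Variables (phi : T1 -> T2) (g : T1 -> R).
Hypotheses (mphi : measurable_fun setT phi) (mg : measurable_fun setT g).
Hypothesis g0 : forall x, 0 <= g x.
Hypothesis nuE : forall A, measurable A ->
  nu A = (\int[mu]_(x in phi @^-1` A) (g x)%:E)%E.
Local Open Scope ereal_scope.
Import HBNNSimple.

Let mphi_preimage A : measurable A -> measurable (phi @^-1` A).
Proof. by move=> mA; rewrite -[X in measurable X]setTI; exact: mphi. Qed.

Let integral_density_nnsfun (f : {nnsfun T2 >-> R}) :
  \int[nu]_y (f y)%:E = \int[mu]_x ((f (phi x))%:E * (g x)%:E).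
Proof.
under [LHS]eq_integral do rewrite fimfunE -fsumEFin//.
rewrite [LHS]ge0_integral_fsum//; last 2 first.
  - by move=> r; exact/measurable_EFinP/measurableT_comp.
  - by move=> n x _; rewrite EFinM nnfun_muleindic_ge0.
under [RHS]eq_integral.
  move=> x xD; rewrite fimfunE -fsumEFin// ge0_mule_fsuml; last first.
    by move=> r; rewrite EFinM nnfun_muleindic_ge0.
  over.
have mind r : measurable_fun setT (fun x => \1_(f @^-1` [set r]) (phi x) : R).
  by apply: measurableT_comp => //; exact: measurable_indic.
have ind_ge0 r x : (0 <= r * \1_(f @^-1` [set r]) (phi x))%R.
  by rewrite -lee_fin EFinM nnfun_muleindic_ge0.
rewrite [RHS]ge0_integral_fsum//; last 2 first.
  - by move=> r; apply: emeasurable_funM; apply/measurable_EFinP => //;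
      exact: measurable_funM.
  - by move=> n x _; rewrite mule_ge0// -?EFinM ?lee_fin.
apply: eq_fsbigr => r /[!inE] -[y _ fyr].
have r0 : (0 <= r)%R by rewrite -fyr.
under [RHS]eq_integral do rewrite EFinM -muleA.
rewrite [RHS]ge0_integralZl_EFin//; last 2 first.
  - by move=> x _; rewrite mule_ge0// lee_fin.
  - by apply: emeasurable_funM; exact/measurable_EFinP.
rewrite integralZl_indic_nnsfun//; congr (_ * _).
rewrite integral_indic// setIT nuE// [LHS]integral_mkcond.
apply: eq_integral => x _; rewrite /patch indicE.
have -> : (x \in phi @^-1` (f @^-1` [set r])) = (phi x \in f @^-1` [set r]).
  by apply/idP/idP; rewrite !inE.
by case: ifPn => _; rewrite ?mul1e ?mul0e.
Qed.

(** Monotone limits of the case of simple functions. The map [phi] is the identity when members of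
    the family are tilted; later it is also a reward, or the identity onto a coarser
    sigma-algebra. *)
Lemma ge0_integral_density (f : T2 -> \bar R) :
  measurable_fun setT f -> (forall y, 0 <= f y) ->
  \int[nu]_y f y = \int[mu]_x (f (phi x) * (g x)%:E).
Proof.
move=> mf f0; pose f_ := nnsfun_approx measurableT mf.
have f_f y : EFin \o f_ ^~ y @ \oo --> f y by exact: cvg_nnsfun_approx.
have nd y : {homo (fun n => f_ n y) : a b / (a <= b)%N >-> (a <= b)%R}.
  by move=> a b ab; exact/lefP/nd_nnsfun_approx.
transitivity (limn (fun n => \int[nu]_y (f_ n y)%:E)).
  rewrite -monotone_convergence//=.
  - by apply: eq_integral => y _; apply/esym/cvg_lim => //; exact: f_f.
  - by move=> n; exact/measurable_EFinP/measurable_funTS.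
  - by move=> n x _; rewrite lee_fin.
  - by move=> x _ a b ab; rewrite lee_fin; exact: nd.
under eq_fun do rewrite integral_density_nnsfun.
rewrite -monotone_convergence//=.
- apply: eq_integral => x _; apply/cvg_lim => //.
  rewrite -[in X in _ --> X]/((f (phi x)) * (g x)%:E).
  by apply: cvgeZr => //; exact: f_f.
- move=> n; apply: emeasurable_funM => //.
    by apply/measurable_EFinP; apply: measurableT_comp.
  exact/measurable_EFinP.
- by move=> n x _; rewrite mule_ge0// lee_fin.
- by move=> x _ a b ab; rewrite lee_wpmul2r ?lee_fin//; exact: nd.
Qed.

(** Multiplication by the nonnegative [g] commutes with positive and negative parts. *)
Lemma integral_density (f : T2 -> \bar R) : measurable_fun setT f ->
  \int[nu]_y f y = \int[mu]_x (f (phi x) * (g x)%:E).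
Proof.
move=> mf; rewrite integralE [RHS]integralE; congr (_ - _).
  rewrite ge0_integral_density//; last exact: measurable_funepos.
  apply: eq_integral => x _; rewrite !unlock.
  by rewrite maxe_pMl ?lee_fin// mul0e.
rewrite ge0_integral_density//; last exact: measurable_funeneg.
apply: eq_integral => x _; rewrite !unlock.
by rewrite maxe_pMl ?lee_fin// mul0e mulNe.
Qed.

Lemma integrable_density (f : T2 -> \bar R) : nu.-integrable setT f ->
  mu.-integrable setT (fun x => f (phi x) * (g x)%:E).
Proof.
move=> /integrableP[mf fi]; apply/integrableP; split.
  by apply: emeasurable_funM; [exact: measurableT_comp|exact/measurable_EFinP].
rewrite ge0_integral_density// in fi; last exact: measurableT_comp.
apply: le_lt_trans fi; rewrite le_eqVlt; apply/orP; left; apply/eqP.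
by apply: eq_integral => x _; rewrite abseM [X in _ * X]gee0_abs// lee_fin.
Qed.

End integral_wrt_density.

(** The function [expR (l x)] is a version of the Radon-Nikodym derivative. Versions agree almost
    everywhere for [nu'], hence for [nu], which is absolutely continuous with respect to [nu']. *)
Lemma KL_divergence_density (R : realType) (nu nu' : probability R R) (l : R -> R) :
  measurable_fun setT l ->
  (forall A, measurable A -> nu A = (\int[nu']_(x in A) (expR (l x))%:E)%E) ->
  KL_divergence nu nu' = (\int[nu]_x (l x)%:E)%E.
Proof.
move=> ml nuE; have mel : measurable_fun setT (fun x => expR (l x)).
  exact: measurableT_comp.
have nunu' : nu `<< nu'.
  apply/null_content_dominatesP => A mA nu'A0; rewrite nuE//.
  by apply: null_set_integral => //; exact/measurable_EFinP/measurable_funTS.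
have RN_E : ae_eq nu' setT ('d (charge_of_finite_measure nu) '/d nu')
    (fun x => (expR (l x))%:E).
  apply: integral_ae_eq => //.
  - exact: Radon_Nikodym_integrable.
  - exact/measurable_EFinP.
  by move=> E _ mE; rewrite -Radon_Nikodym_integral// -nuE.
have {}RN_E : ae_eq nu setT ('d (charge_of_finite_measure nu) '/d nu')
    (fun x => (expR (l x))%:E).
  exact: null_dominates_ae_eq RN_E.
rewrite /KL_divergence; apply: ae_eq_integral_total.
apply: filterS RN_E => x /[apply] ->.
by rewrite lne_EFin ?expR_gt0// expRK.
Qed.

(** * Bregman divergence of the log-partition function *)

Section derivative_in_theory.
Variable R : realType.
Implicit Types (D A : set R) (f : R -> R) (x l : R).

Lemma derivative_in_dist D f x l : derivative_in D f x l ->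
  forall e, 0 < e -> exists2 r, 0 < r &
    forall y, D y -> y != x -> `|y - x| < r ->
      `|(f y - f x) / (y - x) - l| < e.
Proof.
move=> /cvgrPdist_lt dfl e e0.
have /nbhs_ballP[r /= r0 h] := dfl _ e0; exists r => // y Dy yx yxr.
by rewrite distrC; apply: h => //=; rewrite /ball/= distrC.
Qed.

Lemma derivative_in_is_derive D f x l (a b : R) : x \in `]a, b[ ->
  `]a, b[ `<=` D -> derivative_in D f x l -> is_derive x 1 f l.
Proof.
rewrite in_itv/= => /andP[ax xb] abD dfl.
have H : h^-1 *: ((f \o shift x) (h *: 1) - f x) @[h --> 0^'] --> l.
  apply/cvgrPdist_lt => e e0; have [r r0 h] := derivative_in_dist dfl e0.
  have r'0 : 0 < Num.min r (Num.min (x - a) (b - x)).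
    by rewrite !lt_min r0 !subr_gt0 ax xb.
  apply/nbhs_ballP; exists (Num.min r (Num.min (x - a) (b - x))) => // y.
  rewrite /ball/= sub0r normrN !lt_min => /and3P[yr yxa ybx] y0.
  have [yxa1 ybx1] : y > - (x - a) /\ y < b - x.
    by move: yxa ybx; rewrite !ltr_norml => /andP[? ?] /andP[? ?]; split.
  rewrite distrC /= [y *: 1]mulr1 [_ *: _]mulrC -[y in y^-1](addrK x).
  apply: h; last by rewrite addrK.
  - by apply: abD; rewrite /= in_itv/=; lra.
  - by rewrite -subr_eq0 addrK.
split; first by apply/cvg_ex; exists l.
exact: cvg_lim H.
Qed.

Lemma derivative_in_continuous D A f (f' : R -> R) : A `<=` D ->
  (forall x, A x -> derivative_in D f x (f' x)) -> {within A, continuous f}.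
Proof.
move=> AD df; apply/subspace_continuousP => x Ax; apply/cvgrPdist_lt => e e0.
(* Near [x] the difference quotient is within 1 of [f' x], so increments of [f] are at most
   [1 + |f' x|] times those of the argument. *)
have [r r0 h] := derivative_in_dist (df x Ax) ltr01.
have c0 : 0 < 1 + `|f' x| by rewrite ltr_pwDl.
have r'0 : 0 < Num.min r (e / (1 + `|f' x|)) by rewrite lt_min r0 divr_gt0.
apply/nbhs_ballP; exists (Num.min r (e / (1 + `|f' x|))) => // y.
rewrite /ball/= distrC lt_min ltr_pdivlMr// => /andP[yr ye] Ay.
have [->|yx] := eqVneq y x; first by rewrite subrr normr0.
rewrite distrC; apply: le_lt_trans ye.
have yx0 : y - x != 0 by rewrite subr_eq0.
rewrite -[f y - f x](divfK yx0) normrM mulrC ler_wpM2l//.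
have := ltW (h y (AD _ Ay) yx yr).
by rewrite -lerBlDr; apply: le_trans; rewrite lerB_dist.
Qed.

End derivative_in_theory.

Definition bregman (R : realType) (b f1 : R -> R) (s t : R) : R :=
  b t - b s - (t - s) * f1 s.

Section bregman_divergence.
Variables (R : realType) (Theta : interval R) (b f1 f2 : R -> R).
Hypothesis bD : forall x, x \in Theta -> derivative_in [set` Theta] b x (f1 x).
Hypothesis f1D : forall x, x \in Theta -> derivative_in [set` Theta] f1 x (f2 x).
Hypothesis f2_gt0 : forall x, x \in Theta -> 0 < f2 x.
Local Notation D := (bregman b f1).
Implicit Types s t p q x z c v : R.

Let Theta_conv s t x : s \in Theta -> t \in Theta -> s <= x <= t -> x \in Theta.
Proof. by move=> sT tT; apply: (@interval_is_interval _ Theta s t). Qed.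

Let itv_sub s t : s \in Theta -> t \in Theta -> `[s, t] `<=` [set` Theta].
Proof. by move=> sT tT x /=; rewrite in_itv/=; exact: Theta_conv. Qed.

Lemma MVT_derivative_in (f f' : R -> R) s t :
  (forall x, x \in Theta -> derivative_in [set` Theta] f x (f' x)) ->
  s \in Theta -> t \in Theta -> s < t ->
  exists2 c, s < c < t & f t - f s = f' c * (t - s).
Proof.
move=> fD sT tT st; have [||c] := @MVT _ f f' s t st.
- move=> x xst; have xT : x \in Theta.
    by apply: (Theta_conv sT tT); move: xst; rewrite in_itv/= => /andP[/ltW-> /ltW->].
  apply: derivative_in_is_derive xst _ (fD _ xT).
  by apply: subset_trans (itv_sub sT tT); exact: subset_itv_oo_cc.
- apply: (derivative_in_continuous (itv_sub sT tT)) => x /(itv_sub sT tT).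
  exact: fD.
- by rewrite in_itv/=; exists c.
Qed.

Lemma lt_derivative1 s t : s \in Theta -> t \in Theta -> s < t -> f1 s < f1 t.
Proof.
move=> sT tT st; have [c /andP[sc ct] E] := MVT_derivative_in f1D sT tT st.
by rewrite -subr_gt0 E mulr_gt0 ?subr_gt0// f2_gt0// (Theta_conv sT tT)// !ltW.
Qed.

(** Translates comparisons of means into comparisons of natural parameters, and makes the parameter
    a function of the mean. *)
Lemma le_derivative1 s t : s \in Theta -> t \in Theta ->
  (f1 s <= f1 t) = (s <= t).
Proof.
move=> sT tT; case: (ltgtP s t) => [st|ts|->]; last by rewrite lexx.
- by rewrite ltW// lt_derivative1.
- by rewrite leNgt lt_derivative1.
Qed.

Lemma IVT_derivative1 s t z : s \in Theta -> t \in Theta -> s <= t ->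
  f1 s <= z <= f1 t -> exists2 p, s <= p <= t & f1 p = z.
Proof.
move=> sT tT st /andP[sz zt]; have [||c] := @IVT _ f1 s t z st.
- apply: (derivative_in_continuous (itv_sub sT tT)) => x /(itv_sub sT tT).
  exact: f1D.
- by rewrite ge_min sz/= le_max zt orbT.
- by rewrite in_itv/=; exists c.
Qed.

Lemma bregmanxx s : D s s = 0.
Proof. by rewrite /bregman; ring. Qed.

Lemma bregman_gt0 s t : s \in Theta -> t \in Theta -> s != t -> 0 < D s t.
Proof.
move=> sT tT; rewrite neq_lt => /orP[st|ts]; rewrite /bregman.
- have [c /andP[sc ct] ->] := MVT_derivative_in bD sT tT st.
  have := lt_derivative1 sT (Theta_conv sT tT _) sc; rewrite !ltW// => /(_ isT) h.
  by rewrite mulrC -mulrBr mulr_gt0// subr_gt0.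
- have [c /andP[sc ct] E] := MVT_derivative_in bD tT sT ts.
  have := lt_derivative1 (Theta_conv tT sT _) sT ct; rewrite !ltW// => /(_ isT) h.
  rewrite (_ : _ - _ = (s - t) * (f1 s - f1 c)) ?mulr_gt0 ?subr_gt0//.
  by rewrite mulrBr [_ * f1 c]mulrC -E; ring.
Qed.

Lemma bregman_ge0 s t : s \in Theta -> t \in Theta -> 0 <= D s t.
Proof.
move=> sT tT; have [->|st] := eqVneq s t; first by rewrite bregmanxx.
by rewrite ltW// bregman_gt0.
Qed.

(** Three-point identity; the last product is nonnegative when [p] lies between [s] and [t]. *)
Lemma bregman_split p s t : D s t = D s p + D p t + (t - p) * (f1 p - f1 s).
Proof. by rewrite /bregman; ring. Qed.

Lemma bregman_superadditive s p t : s \in Theta -> t \in Theta ->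
  s <= p -> p <= t -> D s p + D p t <= D s t.
Proof.
move=> sT tT sp pt; have pT : p \in Theta by rewrite (Theta_conv sT tT)// sp.
by rewrite (bregman_split p s t) lerDl mulr_ge0 ?subr_ge0// le_derivative1.
Qed.

(* For s <= t, split [s, t] at the parameter p whose mean is halfway: D s t exceeds
   (t - p) (f1 p - f1 s), where both v (t - p) and f1 p - f1 s are at least half of
   |f1 t - f1 s|. *)
Lemma bregman_lower_bound s t v : s \in Theta -> t \in Theta ->
  (forall x, x \in Theta -> Num.min s t <= x <= Num.max s t -> f2 x <= v) ->
  (f1 t - f1 s) ^+ 2 <= 4 * v * D s t.
Proof.
move=> sT tT f2v.
have slope x y : x \in Theta -> y \in Theta -> x <= y ->
    Num.min s t <= x -> y <= Num.max s t -> f1 y - f1 x <= v * (y - x).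
  move=> xT yT le_xy stx yst; have [->|neq_xy] := eqVneq x y.
    by rewrite !subrr mulr0.
  have xy : x < y by rewrite lt_neqAle neq_xy.
  have [c /andP[xc cy] ->] := MVT_derivative_in f1D xT yT xy.
  rewrite ler_wpM2r ?subr_ge0 ?(ltW xy)//.
  rewrite f2v ?(Theta_conv xT yT) ?(ltW xc) ?(ltW cy)//.
  by rewrite (le_trans stx (ltW xc)) (le_trans (ltW cy) yst).
have v0 : 0 <= v.
  apply: (@le_trans _ _ (f2 s)); first by rewrite ltW// f2_gt0.
  by apply: f2v; rewrite // ge_min le_max lexx.
set z := (f1 s + f1 t) / 2.
have [st|ts] := leP s t.
- have fst : f1 s <= f1 t by rewrite le_derivative1.
  have [|p /andP[sp pt] fp] := @IVT_derivative1 s t z sT tT st.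
    by rewrite /z; lra.
  have pT : p \in Theta by rewrite (Theta_conv sT tT)// sp.
  have := slope p t pT tT pt; rewrite ge_min sp le_max lexx orbT => /(_ isT isT).
  rewrite fp (bregman_split p s t) fp => h.
  have := bregman_ge0 sT pT; have := bregman_ge0 pT tT => h1 h2.
  have h3 : (f1 t - z) * (z - f1 s) <= v * (t - p) * (z - f1 s).
    by apply: ler_wpM2r => //; rewrite /z; lra.
  have h4 : 0 <= v * (D s p + D p t) by rewrite mulr_ge0// addr_ge0.
  have -> : (f1 t - f1 s) ^+ 2 = 4 * ((f1 t - z) * (z - f1 s)).
    by rewrite /z; field.
  by lra.
- have fst : f1 t <= f1 s by rewrite le_derivative1// ltW.
  have [|p /andP[sp pt] fp] := @IVT_derivative1 t s z tT sT (ltW ts).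
    by rewrite /z; lra.
  have pT : p \in Theta by rewrite (Theta_conv tT sT)// sp.
  have := slope t p tT pT sp; rewrite ge_min lexx orbT le_max pt => /(_ isT isT).
  rewrite fp (bregman_split p s t) fp => h.
  have := bregman_ge0 sT pT; have := bregman_ge0 pT tT => h1 h2.
  have h3 : (z - f1 t) * (f1 s - z) <= v * (p - t) * (f1 s - z).
    by apply: ler_wpM2r => //; rewrite /z; lra.
  have h4 : 0 <= v * (D s p + D p t) by rewrite mulr_ge0// addr_ge0.
  have -> : (f1 t - f1 s) ^+ 2 = 4 * ((z - f1 t) * (f1 s - z)).
    by rewrite /z; field.
  by lra.
Qed.

(** Intermediate values in the first argument, along which the divergence to [t] runs continuously
    from [D s t] to [D t t = 0]. *)
Lemma bregman_level s t c : s \in Theta -> t \in Theta -> s <= t ->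
  0 <= c <= D s t -> exists2 p, s <= p <= t & D p t = c.
Proof.
move=> sT tT st /andP[c0 cD].
have [||p] := @IVT _ (D ^~ t) s t c st.
- apply/subspace_continuousP => x xst.
  have cont f (f' : R -> R) :
      (forall x, x \in Theta -> derivative_in [set` Theta] f x (f' x)) ->
      f y @[y --> within `[s, t] (nbhs x)] --> f x.
    move=> fD; apply: (subspace_continuousP _ _).1 => //.
    apply: (derivative_in_continuous (itv_sub sT tT)) => y /(itv_sub sT tT).
    exact: fD.
  apply: cvgB.
    apply: cvgB; [exact: cvg_cst|exact: cont bD].
  apply: cvgM; last exact: cont f1D.
  apply: cvgB; [exact: cvg_cst|].
  exact: cvg_within.
- by rewrite bregmanxx ge_min c0 orbT/= le_max cD.
- by rewrite in_itv/=; exists p.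
Qed.

(** If [p < s], superadditivity gives [D p t >= D p s + D s t > D s t]. *)
Lemma bregman_sublevel s p t : s \in Theta -> p \in Theta -> t \in Theta ->
  s <= t -> p <= t -> D p t <= D s t -> s <= p.
Proof.
move=> sT pT tT st pt; apply: contraTT; rewrite -!ltNge => ps.
apply: (@lt_le_trans _ _ (D p s + D s t)).
  by rewrite ltrDr bregman_gt0// lt_eqF.
by rewrite bregman_superadditive// ltW.
Qed.

End bregman_divergence.

(** * Moments and divergences of the members of an exponential family *)

Section moments_from_exponential_moments.
Variable R : realType.
Implicit Types (u t l v : R).

Lemma expR_subr1_le v : expR v - 1 <= v * expR v.
Proof.
have := expR_ge1Dx (- v); rewrite -(ler_pM2r (expR_gt0 v)) -expRD addNr expR0.
by rewrite mulrDl; lra.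
Qed.

Lemma expR_subr1_ge v : v <= expR v - 1.
Proof. by have := expR_ge1Dx v; lra. Qed.

(** Convexity of the exponential between 0 and [v]: the tangent at [u * v] lies below the graph at
    both ends, and the two inequalities are averaged with weights [u] and [1 - u]. *)
Lemma expR_secant_le u v : 0 <= u <= 1 -> expR (u * v) - 1 <= u * (expR v - 1).
Proof.
move=> /andP[u0 u1]; set w := u * v.
have h1 : expR w * (1 + (v - w)) <= expR v.
  have -> : expR v = expR w * expR (v - w) by rewrite -expRD subrKC.
  by rewrite ler_wpM2l ?expR_ge0 ?expR_ge1Dx.
have h2 : expR w * (1 - w) <= 1.
  rewrite -[leRHS]expR0 -(subrr w) expRD.
  by rewrite ler_wpM2l ?expR_ge0 ?expR_ge1Dx.
have h3 := ler_wpM2l u0 h1; have u1' : 0 <= 1 - u by lra.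
have h4 := ler_wpM2l u1' h2.
have E : expR w = u * (expR w * (1 + (v - w))) + (1 - u) * (expR w * (1 - w)).
  by rewrite /w; ring.
by rewrite {1}E; lra.
Qed.

(** Squeezing [exp u - 1] between [u] and [u exp u] avoids dividing by [u_ n], which may vanish. *)
Lemma cvg_expR_subr1_div (u_ t_ : nat -> R) l : (forall n, 0 < t_ n) ->
  u_ @ \oo --> 0 -> (fun n => u_ n / t_ n) @ \oo --> l ->
  (fun n => (expR (u_ n) - 1) / t_ n) @ \oo --> l.
Proof.
move=> t0 u0 ul; apply: (@squeeze_cvgr _ _ _ _ (fun n => u_ n / t_ n)
    (fun n => u_ n / t_ n * expR (u_ n))) => //.
  apply: nearW => n; rewrite ler_pM2r ?invr_gt0// expR_subr1_ge/=.
  by rewrite mulrAC ler_pM2r ?invr_gt0// expR_subr1_le.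
rewrite (_ : l = l * expR 0); last by rewrite expR0 mulr1.
apply: cvgM => //.
by apply: continuous_cvg => //; exact: continuous_expR.
Qed.

Section random_variable.
Context d (T : measurableType d) (P : probability T R) (X : T -> R).
Hypothesis mX : measurable_fun setT X.

(* G n decreases to X: secant slopes of expR at 0. Being one-sided in t, this also
   reaches the endpoints of an interval of exponential moments. *)
Local Notation t n := (n.+1%:R^-1 : R).
Let G n x := (expR (t n * X x) - 1) / t n.

Let t_gt0 n : 0 < t n. Proof. by rewrite invr_gt0. Qed.

Let mG n : measurable_fun setT (G n).
Proof.
apply: measurable_funM => //; apply: measurable_funB => //.
by apply: measurableT_comp => //; exact: measurable_funM.
Qed.

Let G_ge n x : X x <= G n x.
Proof. by rewrite ler_pdivlMr// mulrC expR_subr1_ge. Qed.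

Let G_anti n k x : (n <= k)%N -> G k x <= G n x.
Proof.
move=> nk; have tkn : t k <= t n by rewrite lef_pV2 ?posrE// ler_nat ltnS.
have u01 : 0 <= t k / t n <= 1.
  by rewrite divr_ge0 ?(ltW (t_gt0 _))//= ler_pdivrMr// mul1r.
have := expR_secant_le (t n * X x) u01.
rewrite mulrA divfK ?gt_eqF// => h; rewrite /G ler_pdivrMr//.
by rewrite mulrAC [X in _ <= X](_ : _ = t k / t n * (expR (t n * X x) - 1))//; ring.
Qed.

Let cvg_G x : (fun n => G n x) @ \oo --> X x.
Proof.
apply: cvg_expR_subr1_div => //.
  by rewrite -[0](mul0r (X x)); apply: cvgMl; exact: cvg_harmonic.
by apply: cvg_near_cst; apply: nearW => n; rewrite mulrAC divff ?mul1r// gt_eqF.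
Qed.

(** Monotone convergence applies to the increasing nonnegative functions [G 0 - G n]. The finite
    limit of their integrals makes [G 0 - X], and so [X], integrable. *)
Lemma cvg_exponential_moments_mean (M : nat -> R) l :
  (forall n, \int[P]_x (expR (t n * X x))%:E = (M n)%:E)%E ->
  (fun n => (M n - 1) / t n) @ \oo --> l ->
  P.-integrable setT (EFin \o X) /\ (\int[P]_x (X x)%:E = l%:E)%E.
Proof.
move=> ME Ml.
have iexp n : P.-integrable setT (fun x => (expR (t n * X x))%:E).
  apply/integrableP; split.
    apply/measurable_EFinP; apply: measurableT_comp => //.
    exact: measurable_funM.
  under eq_integral do rewrite gee0_abs ?lee_fin ?expR_ge0//.
  by rewrite ME ltry.
have i1 : P.-integrable setT (cst (1%R%:E)).
  exact: (finite_measure_integrable_cst P 1).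
have GE n : EFin \o G n =
    (fun x => (t n)^-1%:E * ((expR (t n * X x))%:E - cst (1%R%:E) x))%E.
  by apply/funext => x /=; rewrite -EFinB -EFinM mulrC.
have iG n : P.-integrable setT (EFin \o G n).
  rewrite GE; apply: integrableZl => //; exact: integrableB.
have GME n : (\int[P]_x (G n x)%:E = ((M n - 1) / t n)%:E)%E.
  rewrite -[LHS]/(\int[P]_x ((EFin \o G n) x))%E GE integralZl//; last first.
    exact: integrableB.
  rewrite integralB// ME integral_cst_probability.
  by rewrite -EFinB -EFinM mulrC.
pose F n x := (G 0 x - G n x)%:E.
have FE : (\int[P]_x (G 0 x - X x)%:E = ((M 0 - 1) / t 0 - l)%:E)%E.
  have Fcvg : (\int[P]_x F n x)%E @[n --> \oo] --> (\int[P]_x (G 0 x - X x)%:E)%E.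
    rewrite (_ : \int[P]_x _ = \int[P]_x limn (F ^~ x))%E; last first.
      apply: eq_integral => x _; apply/esym/cvg_lim => //.
      by apply: cvg_EFin; [exact: nearW|apply: cvgB; [exact: cvg_cst|exact: cvg_G]].
    apply: cvg_monotone_convergence => //.
    - by move=> n; apply/measurable_EFinP; exact: measurable_funB.
    - by move=> n x _; rewrite lee_fin subr_ge0 G_anti.
    - by move=> x _ n k nk; rewrite lee_fin lerB// G_anti.
  apply: cvg_unique Fcvg _ => //.
  rewrite (_ : (fun n => _) = (EFin \o (fun n => (M 0 - 1) / t 0 - (M n - 1) / t n))).
    by apply: cvg_EFin; [exact: nearW|apply: cvgB => //; exact: cvg_cst].
  apply/funext => n; rewrite /F.
  under eq_integral do rewrite EFinB.
  by rewrite integralB_EFin// !GME.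
have iF : P.-integrable setT (EFin \o (fun x => G 0 x - X x)).
  apply/integrableP; split.
    by apply/measurable_EFinP; exact: measurable_funB.
  under eq_integral do rewrite /= ger0_norm ?subr_ge0//.
  by rewrite FE ltry.
have XE : EFin \o X = ((EFin \o G 0) \- (EFin \o (fun x => G 0 x - X x)%R))%E.
  by apply/funext => x /=; rewrite -EFinB; congr EFin; ring.
split; first by rewrite XE; exact: integrableB.
rewrite -[LHS]/(\int[P]_x ((EFin \o X) x))%E XE integralB//.
by rewrite -[X in (X - _)%E]/(\int[P]_x (G 0 x)%:E)%E GME FE -EFinB; congr EFin; ring.
Qed.

(** [G n] has the sign of [X], so these functions are nonnegative; they converge pointwise to the
    square of [X]. *)
Let H n x := X x * G n x.

Let H_ge0 n x : 0 <= H n x.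
Proof.
have [X0|X0] := leP 0 (X x); first by rewrite mulr_ge0// (le_trans X0).
rewrite /H /G -mulrNN mulr_ge0// oppr_ge0 ?(ltW X0)//.
rewrite pmulr_lle0 ?invr_gt0// subr_le0 -[leRHS]expR0 ler_expR.
by rewrite pmulr_rle0// ltW.
Qed.

(** Where [X >= 0], [G n] is at most [G 0]; where [X < 0], [G n] lies between [X] and 0. *)
Let H_le n x : H n x <= X x ^+ 2 + H 0 x.
Proof.
have [X0|X0] := leP 0 (X x).
  apply: (@le_trans _ _ (H 0 x)); last by rewrite lerDr sqr_ge0.
  by rewrite ler_wpM2l// G_anti.
apply: (@le_trans _ _ (X x ^+ 2)); last by rewrite lerDl.
by rewrite expr2 ler_nM2l.
Qed.

(** Fatou's lemma first gives integrability of the square. Then [X ^+ 2 + H 0] is an integrable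
    bound for all [H n], and dominated convergence identifies the integral. *)
Lemma cvg_exponential_moments_sqr (M : nat -> R) l :
  (forall n, P.-integrable setT (fun x => (X x * ((expR (t n * X x) - 1) / t n))%:E)) ->
  (forall n, \int[P]_x (X x * ((expR (t n * X x) - 1) / t n))%:E = (M n)%:E)%E ->
  M @ \oo --> l ->
  P.-integrable setT (fun x => (X x ^+ 2)%:E) /\
  (\int[P]_x (X x ^+ 2)%:E = l%:E)%E.
Proof.
move=> iH ME Ml.
have mX2 : measurable_fun setT (fun x => (X x ^+ 2)%:E).
  by apply/measurable_EFinP; exact: measurable_funX.
have cvg_H x : (H n x)%:E @[n --> \oo] --> (X x ^+ 2)%:E.
  apply: cvg_EFin; first exact: nearW.
  by rewrite expr2; apply: cvgMr; exact: cvg_G.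
have MlE : (\int[P]_x (H n x)%:E)%E @[n --> \oo] --> l%:E.
  by under eq_fun do rewrite ME; apply: cvg_EFin => //; exact: nearW.
have iX2 : P.-integrable setT (fun x => (X x ^+ 2)%:E).
  apply/integrableP; split=> //.
  under eq_integral do rewrite gee0_abs ?lee_fin ?sqr_ge0//.
  apply: (@le_lt_trans _ _ l%:E); last exact: ltry.
  rewrite -(cvg_limn_einf_sup MlE).1.
  apply: (le_trans _ (fatou P measurableT (f := fun n x => (H n x)%:E) _ _));
    last 2 first.
  - by move=> n; apply/measurable_EFinP; exact: measurable_funM.
  - by move=> n x _; rewrite lee_fin.
  rewrite le_eqVlt; apply/orP; left; apply/eqP; apply: eq_integral => x _.
  by rewrite (cvg_limn_einf_sup (cvg_H x)).1.
split=> //.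
have mH n : measurable_fun setT (fun x => (H n x)%:E).
  by apply/measurable_EFinP; exact: measurable_funM.
have H_dom : {ae P, forall x n, setT x ->
    (`|(H n x)%:E| <= (X x ^+ 2)%:E + (H 0 x)%:E)%E}.
  by apply: aeW => x n _; rewrite gee0_abs -?EFinD ?lee_fin.
have [_ _ lim_int] := dominated_convergence measurableT mH mX2
  (aeW P (fun x _ => cvg_H x)) (integrableD measurableT iX2 (iH 0%N)) H_dom.
exact: cvg_unique lim_int MlE.
Qed.

End random_variable.
End moments_from_exponential_moments.

Section exponential_family_members.
Variables (R : realType) (m : {measure set R -> \bar R}) (Theta : interval R).
Hypothesis partition_fin : forall theta, theta \in Theta ->
  (0 < partition_function m theta < +oo)%E.
Local Notation b := (log_partition m).
Implicit Types (nu : probability R R) (s t theta : R).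

Definition member_at theta nu := forall A : set R, measurable A ->
  nu A = (\int[m]_(x in A) (expR (x * theta - b theta))%:E)%E.

Let mdens theta : measurable_fun setT (fun x : R => expR (x * theta - b theta)).
Proof.
apply: measurableT_comp => //; apply: measurable_funB => //.
exact: measurable_funM.
Qed.

Lemma partition_functionE theta : theta \in Theta ->
  partition_function m theta = (expR (b theta))%:E.
Proof.
move=> /partition_fin /andP[p0 poo]; rewrite /log_partition lnK.
  by rewrite fineK// gt0_fin_numE.
by rewrite posrE fine_gt0// p0.
Qed.

Lemma integral_member_density theta : theta \in Theta ->
  (\int[m]_x (expR (x * theta - b theta))%:E = 1)%E.
Proof.
move=> thetaT; under eq_integral do rewrite expRD mulrC EFinM.
rewrite ge0_integralZl_EFin//.
- rewrite -/(partition_function m theta) partition_functionE// -EFinM -expRD.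
  by rewrite addNr expR0.
- by apply/measurable_EFinP; apply: measurableT_comp => //; exact: measurable_funM.
Qed.

Lemma exists_member_at theta : theta \in Theta -> exists nu, member_at theta nu.
Proof.
move=> thetaT; apply: exists_probability_of_density => //.
- exact: integral_member_density.
Qed.

Lemma exp_familyP nu : exp_family m Theta nu <->
  exists2 theta, theta \in Theta & member_at theta nu.
Proof. by []. Qed.

Let mtilt s t : measurable_fun setT (fun x : R => expR ((s - t) * x - (b s - b t))).
Proof.
by apply: measurableT_comp => //; exact: measurable_funB.
Qed.

Lemma member_at_tilt s t nu nu' : member_at s nu -> member_at t nu' ->
  forall A : set R, measurable A ->
    nu A = (\int[nu']_(x in A) (expR ((s - t) * x - (b s - b t)))%:E)%E.
Proof.
have densE (x : R) : x * s - b s = (s - t) * x - (b s - b t) + (x * t - b t) by ring.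
move=> nuE nu'E A mA; rewrite nuE// integral_mkcond [RHS]integral_mkcond.
rewrite (ge0_integral_density (phi := id)
  (g := fun x : R => expR (x * t - b t)) _ (mdens t) _ nu'E)//.
- apply: eq_integral => x _; rewrite /patch; case: ifPn => _; last by rewrite mul0e.
  by rewrite -EFinM -expRD -densE.
- apply/(measurable_restrictT _ _).1 => //.
  exact/measurable_funTS/measurable_EFinP.
- by move=> x; apply: erestrict_ge0 => y _; rewrite lee_fin expR_ge0.
Qed.

(** The integrand is the density of the member at [s] relative to the member at [t]. This normalized
    exponential moment drives the martingale used for deviations. *)
Lemma member_at_mgf s t nu : s \in Theta -> t \in Theta -> member_at t nu ->
  (\int[nu]_x (expR ((s - t) * x - (b s - b t)))%:E = 1)%E.
Proof.
move=> sT tT nut; have [nus nusE] := exists_member_at sT.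
by rewrite -(member_at_tilt nusE nut)// (probability_setT nus).
Qed.

(** * Mean, variance and divergence of members through [f1], [f2] and [bregman] *)

Section nondegenerate.
Variables (f1 f2 : R -> R).
Hypothesis bD : forall x, x \in Theta -> derivative_in [set` Theta] b x (f1 x).
Hypothesis f1D : forall x, x \in Theta -> derivative_in [set` Theta] f1 x (f2 x).
Hypothesis f2_gt0 : forall x, x \in Theta -> 0 < f2 x.
Hypothesis Theta_nondegenerate : exists s t, [/\ s \in Theta, t \in Theta & s != t].

Local Notation step n := (n.+1%:R^-1 : R).

(** The direction [h] may have either sign, since only one side is available at an endpoint of
    [Theta]. Moments of [x] are obtained from those of [h * x] along the points
    [t + h / (n + 1)]. *)
Let exists_other t : t \in Theta -> exists2 h, h != 0 & t + h \in Theta.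
Proof.
have [s [s' [sT s'T ss']]] := Theta_nondegenerate => tT.
have [st|st] := eqVneq s t.
  by exists (s' - t); rewrite ?subr_eq0 -?st 1?eq_sym// subrKC.
by exists (s - t); rewrite ?subr_eq0// subrKC.
Qed.

Let segment_in t h n : t \in Theta -> t + h \in Theta -> t + step n * h \in Theta.
Proof.
move=> tT thT.
have t01 : 0 < step n <= 1 by rewrite invr_gt0 invf_le1 ?ler1n ?ltr0n.
have [h0|h0] := leP 0 h.
  apply: (@interval_is_interval _ Theta t (t + h)) => //.
  by rewrite lerDl mulr_ge0 ?(ltW (andP t01).1)// lerD2l ler_piMl//; case/andP: t01.
apply: (@interval_is_interval _ Theta (t + h) t) => //.
by move: (step n) t01 => u /andP[u0 u1]; apply/andP; split; nra.
Qed.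

Let quotient_cvg (f : R -> R) l t h : t \in Theta -> h != 0 -> t + h \in Theta ->
  derivative_in [set` Theta] f t l ->
  (fun n => (f (t + step n * h) - f t) / step n) @ \oo --> h * l.
Proof.
move=> tT h0 thT fD.
have -> : (fun n => (f (t + step n * h) - f t) / step n) =
    (fun n => h * ((f (t + step n * h) - f t) / (t + step n * h - t))).
  apply/funext => n; have : step n != 0 by rewrite invr_eq0 pnatr_eq0.
  move: (step n) => u u0; rewrite (_ : t + u * h - t = u * h); last by ring.
  by field; rewrite ?h0 ?u0.
apply: cvgMr; apply/cvgrPdist_lt => e e0.
have [r r0 H] := derivative_in_dist fD e0.
have : step n * h @[n --> \oo] --> 0.
  by rewrite -[0](mul0r h); apply: cvgMl; exact: cvg_harmonic.
move=> /cvgrPdist_lt/(_ _ r0); apply: filterS => n; rewrite sub0r normrN => nr.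
rewrite distrC; apply: H.
- exact: segment_in.
- by rewrite -subr_eq0 [t + _ - t]addrC addKr mulf_neq0// invr_eq0 pnatr_eq0.
- by rewrite [t + _ - t]addrC addKr.
Qed.

Let b_cvg t h : t \in Theta -> h != 0 -> t + h \in Theta ->
  (fun n => b (t + step n * h) - b t) @ \oo --> 0.
Proof.
move=> tT h0 thT; have -> : (fun n => b (t + step n * h) - b t) =
    (fun n => (b (t + step n * h) - b t) / step n * step n).
  by apply/funext => n; rewrite divfK// invr_eq0 pnatr_eq0.
rewrite -(mulr0 (h * f1 t)); apply: cvgM; last exact: cvg_harmonic.
by apply: quotient_cvg => //; exact: bD.
Qed.

Let mgf_cvg t h : t \in Theta -> h != 0 -> t + h \in Theta ->
  (fun n => (expR (b (t + step n * h) - b t) - 1) / step n) @ \oo --> h * f1 t.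
Proof.
move=> tT h0 thT; apply: cvg_expR_subr1_div.
- by move=> n; rewrite invr_gt0.
- exact: b_cvg.
- by apply: quotient_cvg => //; exact: bD.
Qed.

Let mgf t h n nu : t \in Theta -> t + h \in Theta -> member_at t nu ->
  (\int[nu]_x (expR (step n * (h * x)))%:E = (expR (b (t + step n * h) - b t))%:E)%E.
Proof.
move=> tT thT nut; have sT := segment_in n tT thT.
have := member_at_mgf sT tT nut.
under eq_integral => x _.
  rewrite [t + _ - t]addrC addKr expRD mulrC EFinM -mulrA.
  over.
rewrite ge0_integralZl_EFin//; last first.
- apply/measurable_EFinP; apply: measurableT_comp => //.
  by apply: measurable_funM => //; exact: measurable_funM.
move=> /(congr1 (fun z => (expR (b (t + step n * h) - b t))%:E * z)%E).
by rewrite muleA -EFinM -expRD subrr expR0 mul1e mule1.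
Qed.

(** The exponential moments of [h * x] are increments of [b], exponentiated; their difference
    quotients tend to [h * f1 t]. *)
Lemma member_at_mean t nu : t \in Theta -> member_at t nu ->
  nu.-integrable setT (EFin \o id) /\ (\int[nu]_x x%:E = (f1 t)%:E)%E.
Proof.
move=> tT nut; have [h h0 thT] := exists_other tT.
have mh : measurable_fun setT (fun x : R => h * x) by exact: measurable_funM.
have [iX EX] := cvg_exponential_moments_mean mh
  (fun n => mgf n tT thT nut) (mgf_cvg tT h0 thT).
have i : nu.-integrable setT (EFin \o id).
  have := integrableZl measurableT h^-1 iX.
  by apply: eq_integrable => // x _ /=; rewrite -EFinM mulKf.
split=> //; move: EX; under eq_integral do rewrite EFinM.
rewrite (integralZl measurableT i).
move=> /(congr1 (fun z => h^-1%:E * z)%E).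
by rewrite muleA -!EFinM mulVf// mul1e mulKf.
Qed.

Lemma mean_member_at t nu : t \in Theta -> member_at t nu -> mean nu = f1 t.
Proof.
by move=> tT nut; rewrite /mean unlock (member_at_mean tT nut).2.
Qed.

Lemma member_at_second_moment t nu : t \in Theta -> member_at t nu ->
  nu.-integrable setT (fun x => (x ^+ 2)%:E) /\
  (\int[nu]_x (x ^+ 2)%:E = (f2 t + f1 t ^+ 2)%:E)%E.
Proof.
move=> tT nut; have [h h0 thT] := exists_other tT.
have mh : measurable_fun setT (fun x : R => h * x) by exact: measurable_funM.
have [iX EX] := member_at_mean tT nut.
pose s n := t + step n * h; pose e n := expR (b (s n) - b t).
(* Tilting to the parameter [s n] turns this moment into [e n] times the mean of the member at
   [s n]. *)
have tilted n : nu.-integrable setT (fun x => (x * expR (step n * (h * x)))%:E) /\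
    (\int[nu]_x (x * expR (step n * (h * x)))%:E = (f1 (s n) * e n)%:E)%E.
  have sT : s n \in Theta by exact: segment_in.
  have [nus nusE] := exists_member_at sT.
  have [iXs EXs] := member_at_mean sT nusE.
  have dE x : expR (step n * (h * x)) =
      e n * expR ((s n - t) * x - (b (s n) - b t)).
    by rewrite -expRD /s; congr expR; ring.
  have tiltE := member_at_tilt nusE nut.
  have g0 x : 0 <= expR ((s n - t) * x - (b (s n) - b t)) by exact: expR_ge0.
  have i := integrable_density (phi := id) (@measurable_id _ _ setT)
    (mtilt (s n) t) g0 tiltE iXs.
  have eqE x : (x * expR (step n * (h * x)))%:E =
      ((e n)%:E * (x%:E * (expR ((s n - t) * x - (b (s n) - b t)))%:E))%E.
    by rewrite dE -!EFinM; congr EFin; ring.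
  split.
    have := integrableZl measurableT (e n) i.
    by apply: eq_integrable => // x _; rewrite eqE.
  under eq_integral do rewrite eqE.
  rewrite integralZl// -(integral_density (phi := id) (@measurable_id _ _ setT)
    (mtilt (s n) t) g0 tiltE (f := EFin))//.
  by rewrite EXs -EFinM mulrC.
pose M n := h * ((f1 (s n) * e n - f1 t) / step n).
have HE n x : (h * x * ((expR (step n * (h * x)) - 1) / step n))%:E =
    ((h / step n)%:E * ((x * expR (step n * (h * x)))%:E - x%:E))%E.
  by rewrite -EFinB -EFinM; congr EFin; ring.
have iB n : nu.-integrable setT
    (fun x => (x * expR (step n * (h * x)))%:E - x%:E)%E.
  by apply: integrableB => //; exact: (tilted n).1.
(* Product rule for [f1 * e], in difference-quotient form: the derivative of [e] at [t] along [h] is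
   [h * f1 t]. *)
have Mcvg : M @ \oo --> h ^+ 2 * (f2 t + f1 t ^+ 2).
  have -> : h ^+ 2 * (f2 t + f1 t ^+ 2) = h * (h * f2 t * expR 0 + f1 t * (h * f1 t)).
    by rewrite expR0; ring.
  apply: cvgMr.
  have -> : (fun n => (f1 (s n) * e n - f1 t) / step n) =
      (fun n => (f1 (s n) - f1 t) / step n * e n + f1 t * ((e n - 1) / step n)).
    by apply/funext => n; ring.
  apply: cvgD; last by apply: cvgMr; exact: mgf_cvg.
  apply: cvgM; first by apply: quotient_cvg => //; exact: f1D.
  by apply: continuous_cvg; [exact: continuous_expR|exact: b_cvg].
have iH n : nu.-integrable setT
    (fun x => (h * x * ((expR (step n * (h * x)) - 1) / step n))%:E).
  by under eq_fun do rewrite HE; exact: integrableZl.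
have EH n :
    (\int[nu]_x (h * x * ((expR (step n * (h * x)) - 1) / step n))%:E = (M n)%:E)%E.
  under eq_integral do rewrite HE.
  rewrite integralZl// integralB//; last exact: (tilted n).1.
  by rewrite (tilted n).2 EX -EFinB -EFinM; congr EFin; rewrite /M; ring.
have [iX2 EX2] := cvg_exponential_moments_sqr mh iH EH Mcvg.
have i : nu.-integrable setT (fun x => (x ^+ 2)%:E).
  have := integrableZl measurableT (h ^+ 2)^-1 iX2.
  by apply: eq_integrable => // x _; rewrite -EFinM exprMn mulKf// expf_neq0.
split=> //; move: EX2; under eq_integral do rewrite exprMn EFinM.
rewrite integralZl// => /(congr1 (fun z => (h ^+ 2)^-1%:E * z)%E).
by rewrite muleA -!EFinM mulVf ?expf_neq0// mul1e mulKf ?expf_neq0.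
Qed.

Lemma var_member_at t nu : t \in Theta -> member_at t nu -> var nu = f2 t.
Proof.
move=> tT nut; have [iX EX] := member_at_mean tT nut.
have [iX2 EX2] := member_at_second_moment tT nut.
rewrite /var /variance !unlock EX/=.
have E x : ((x - f1 t) * (x - f1 t))%:E =
    ((x ^+ 2)%:E + ((- (2 * f1 t))%:E * x%:E + cst (f1 t ^+ 2)%:E x))%E.
  by rewrite /= -EFinM -!EFinD; congr EFin; ring.
under eq_integral do rewrite -[X in X%:E]/((_ - f1 t) * (_ - f1 t)) E.
have ic : nu.-integrable setT (cst (f1 t ^+ 2)%:E).
  exact: (finite_measure_integrable_cst nu (f1 t ^+ 2)).
have iZ : nu.-integrable setT (fun x => (- (2 * f1 t))%:E * x%:E)%E.
  exact: integrableZl.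
have Ec : (\int[nu]_x cst (f1 t ^+ 2)%:E x = (f1 t ^+ 2)%:E)%E.
  exact: integral_cst_probability.
rewrite integralD//; last exact: integrableD.
rewrite integralD// EX2 integralZl// EX Ec.
by rewrite -EFinM -!EFinD/=; ring.
Qed.

Lemma mean_spaceP mu : mean_space m Theta mu <-> exists2 t, t \in Theta & f1 t = mu.
Proof.
split=> [[nu /exp_familyP[t tT nut] <-]|[t tT <-]].
  by exists t => //; rewrite (mean_member_at tT nut).
have [nu nut] := exists_member_at tT; exists nu; first by exists t.
exact: mean_member_at.
Qed.

(** The member picked by choice has some parameter with mean [f1 t]; strict monotonicity of [f1]
    forces this parameter to be [t]. *)
Lemma member_at_of_mean t : t \in Theta -> member_at t (member_of_mean m Theta (f1 t)).
Proof.
move=> tT; have [nu nut] := exists_member_at tT.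
have [/exp_familyP[s sT nus]] :
    [set nu | exp_family m Theta nu /\ mean nu = f1 t] (member_of_mean m Theta (f1 t)).
  by apply: getPex; exists nu; split; [exists t|exact: mean_member_at].
rewrite (mean_member_at sT nus) => st.
suff ts : s = t by move: nus; rewrite ts.
apply: le_anti; rewrite -(le_derivative1 f1D f2_gt0 sT tT).
by rewrite -(le_derivative1 f1D f2_gt0 tT sT) st lexx.
Qed.

Lemma variance_function_mean t : t \in Theta -> variance_function m Theta (f1 t) = f2 t.
Proof. by move=> tT; apply: var_member_at => //; exact: member_at_of_mean. Qed.

(** The log-likelihood ratio is affine in [x], so integrating it only requires the mean [f1 s]. *)
Lemma KL_of_means_bregman s t : s \in Theta -> t \in Theta ->
  KL_of_means m Theta (f1 s) (f1 t) = bregman b f1 s t.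
Proof.
move=> sT tT; have [iX EX] := member_at_mean sT (member_at_of_mean sT).
rewrite /KL_of_means (KL_divergence_density (l := fun x => (s - t) * x - (b s - b t))).
- under eq_integral do rewrite EFinB EFinM.
  rewrite integralB//; last 2 first.
  + exact: integrableZl.
  + exact: (finite_measure_integrable_cst _ (b s - b t)).
  rewrite integralZl// EX integral_cst_probability.
  by rewrite /bregman -EFinM -EFinB/=; ring.
- by apply: measurable_funB => //; exact: measurable_funM.
- by apply: member_at_tilt; exact: member_at_of_mean.
Qed.

End nondegenerate.
End exponential_family_members.

(** * Deviations of adaptively sampled empirical means *)

Section integration_against_independent_reward.
Context d (Omega : measurableType d) (R : realType) (P : probability Omega R).
Variables (G : set (set Omega)) (E : set Omega) (X : Omega -> R).
Variable nu : probability R R.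
Local Notation OmegaG := (g_sigma_algebraType G).
Hypothesis sG : <<s G >> `<=` measurable.
Hypotheses (mE : measurable E) (mX : measurable_fun setT X).
Hypothesis indep : forall A (B : set R), <<s G >> A -> measurable B ->
  P (A `&` E `&` X @^-1` B) = (P (A `&` E) * nu B)%E.
Variables (H : Omega -> R) (g : R -> R).
Hypotheses (mH : measurable_fun setT (H : OmegaG -> R)) (H0 : forall w, 0 <= H w).
Hypotheses (mg : measurable_fun setT g) (g0 : forall x, 0 <= g x).
Hypothesis g1 : (\int[nu]_x (g x)%:E = 1)%E.

Let mid : measurable_fun setT (id : Omega -> OmegaG).
Proof. by move=> _ A mA; rewrite setTI; exact: sG. Qed.

Let indicE_integral (A : set Omega) (f : Omega -> R) : measurable A ->
  (\int[P]_(w in A) (\1_E w * f w)%:E = \int[P]_w (f w * \1_(A `&` E) w)%:E)%E.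
Proof.
move=> mA; rewrite integral_mkcond; apply: eq_integral => w _.
rewrite /patch !indicE in_setI; case: ifPn => _ /=; last by rewrite mulr0.
by rewrite mulrC.
Qed.

(** The law of [X] on [A] and [E] is [nu] scaled by the probability of their intersection, and [g]
    has mean 1 under [nu]. *)
Let reward_integral (A : set Omega) : <<s G >> A ->
  (\int[P]_(w in A) (\1_E w * g (X w))%:E = P (A `&` E))%E.
Proof.
move=> GA; have mA := sG GA; have mAE := measurableI _ _ mA mE.
rewrite indicE_integral//.
pose rho := pushforward (mrestr P mAE) X.
have rhoE B : measurable B -> rho B = (\int[P]_(w in X @^-1` B) (\1_(A `&` E) w)%:E)%E.
  move=> mB; rewrite integral_indic//.
    by rewrite /rho/pushforward/mrestr/= setIC.
  by rewrite -[X in measurable X]setTI; exact: mX.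
have c0 : (0 <= fine (P (A `&` E)))%R by rewrite fine_ge0.
have cE : (fine (P (A `&` E)))%:E = P (A `&` E) by rewrite fineK// fin_num_measure.
have rhoE' B : measurable B ->
    rho B = (\int[nu]_(x in id @^-1` B) (cst (fine (P (A `&` E))) x)%:E)%E.
  move=> mB; transitivity (\int[nu]_(x in B) cst (P (A `&` E)) x)%E.
    by rewrite integral_cst// -indep// /rho/pushforward/mrestr/= setIC.
  by rewrite -cE.
have mc : measurable_fun setT (cst (fine (P (A `&` E))) : R -> R).
  exact: measurable_cst.
have mg' : measurable_fun setT (EFin \o g) by exact/measurable_EFinP.
have g0' x : (0 <= (EFin \o g) x)%E by rewrite lee_fin.
have i0 w : 0 <= \1_(A `&` E) w :> R by rewrite indicE.
have /(_ mX) :=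
  ge0_integral_density (nu := rho) mX (measurable_indic mAE) i0 rhoE mg' g0'.
have /(_ mX) := ge0_integral_density (nu := rho) (@measurable_id _ _ setT) mc
  (fun=> c0) rhoE' mg' g0'.
move=> -> /= H1; under eq_integral do rewrite EFinM.
by rewrite -H1 ge0_integralZr//= ?g1 ?mul1e// => x _; rewrite lee_fin.
Qed.

(** On the sigma-algebra of the past, the densities [\1_E] and [\1_E * g (X w)] define the same
    measure, hence give the same integral to every past-measurable [H]. *)
Lemma integral_reward_factor :
  (\int[P]_w (H w * (\1_E w * g (X w)))%:E = \int[P]_w (H w * \1_E w)%:E)%E.
Proof.
pose Q := pushforward (mrestr P mE) (id : Omega -> OmegaG).
have QE A : measurable A -> Q A = (\int[P]_(w in id @^-1` A) (\1_E w)%:E)%E.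
  move=> mA; rewrite integral_indic//; last exact: sG.
  by rewrite /Q/=/pushforward/mrestr/= setIC.
have QE' A : measurable A -> Q A = (\int[P]_(w in id @^-1` A) (\1_E w * g (X w))%:E)%E.
  by move=> mA; rewrite reward_integral.
have mH' : measurable_fun setT (EFin \o (H : OmegaG -> R)) by exact/measurable_EFinP.
have H0' x : (0 <= (EFin \o H) x)%E by rewrite lee_fin.
have i0 w : 0 <= \1_E w :> R by rewrite indicE.
have i0' w : 0 <= \1_E w * g (X w) :> R by rewrite mulr_ge0.
have miX : measurable_fun setT (fun w => \1_E w * g (X w)).
  by apply: measurable_funM => //; exact: measurableT_comp.
have /(_ mid) := ge0_integral_density (nu := Q) mid (measurable_indic mE) i0 QE mH' H0'.
have /(_ mid) := ge0_integral_density (nu := Q) mid miX i0' QE' mH' H0'.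
move=> -> /= H1; under eq_integral do rewrite EFinM; rewrite H1.
by under [RHS]eq_integral do rewrite EFinM.
Qed.

End integration_against_independent_reward.

(** * Expectations of sums of indicators and the union bound *)

Section sums_of_indicators.
Context d (Omega : measurableType d) (R : realType) (P : probability Omega R).
Context (J : eqType).
Implicit Types (s : seq J) (A : set Omega) (B : J -> set Omega).
Local Notation pr A := (fine (P A)).

Lemma measurable_sum_indic s B : (forall i, i \in s -> measurable (B i)) ->
  measurable_fun setT (fun w => \sum_(i <- s) \1_(B i) w : R).
Proof.
elim: s => [|i s IHs] mB.
  by (under eq_fun do rewrite big_nil); exact: measurable_cst.
under eq_fun do rewrite big_cons; apply: measurable_funD.
  by apply: measurable_indic; apply: mB; rewrite inE eqxx.
by apply: IHs => j js; apply: mB; rewrite inE js orbT.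
Qed.

Lemma integral_sum_indicZ s B (c : J -> R) : (forall i, i \in s -> measurable (B i)) ->
  (forall i, 0 <= c i) ->
  (\int[P]_w (\sum_(i <- s) c i * \1_(B i) w)%:E = (\sum_(i <- s) c i * pr (B i))%:E)%E.
Proof.
move=> + c0; elim: s => [|i s IHs] mB.
  by under eq_integral do rewrite big_nil; rewrite integral0 big_nil.
have mBi : measurable (B i) by apply: mB; rewrite inE eqxx.
have mBs j : j \in s -> measurable (B j) by move=> js; apply: mB; rewrite inE js orbT.
have mi : measurable_fun setT (fun w => (\1_(B i) w)%:E : \bar R).
  by apply/measurable_EFinP; exact: measurable_indic.
under eq_integral do rewrite big_cons EFinD.
rewrite ge0_integralD//.
- rewrite IHs// big_cons EFinD; congr (_ + _)%E.
  under eq_integral do rewrite EFinM.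
  rewrite ge0_integralZl_EFin// integral_indic// setIT EFinM fineK//.
  exact: fin_num_measure.
- by move=> w _; rewrite lee_fin mulr_ge0.
- by apply/measurable_EFinP; apply: measurable_funM => //; exact: measurable_indic.
- by move=> w _; rewrite lee_fin; apply: sumr_ge0 => j _; rewrite mulr_ge0.
- apply/measurable_EFinP; elim: (s) mBs => [|j s' IH] mBs'.
    by (under eq_fun do rewrite big_nil); exact: measurable_cst.
  under eq_fun do rewrite big_cons; apply: measurable_funD.
    apply: measurable_funM => //; apply: measurable_indic; apply: mBs'.
    by rewrite inE eqxx.
  by apply: IH => l ls; apply: mBs'; rewrite inE ls orbT.
Qed.

Lemma integral_sum_indic s B : (forall i, i \in s -> measurable (B i)) ->
  (\int[P]_w (\sum_(i <- s) \1_(B i) w)%:E = (\sum_(i <- s) pr (B i))%:E)%E.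
Proof.
move=> mB; have := integral_sum_indicZ (c := fun=> 1) mB (fun=> ler01).
under eq_integral do under eq_bigr do rewrite mul1r.
by under [in RHS]eq_bigr do rewrite mul1r.
Qed.

(** Union bound from an almost sure inequality of indicators; the cover is only almost sure because
    empirical means are means of members only almost surely. *)
Lemma ae_prob_le_sum s A B : measurable A -> (forall i, i \in s -> measurable (B i)) ->
  {ae P, forall w, A w -> exists2 i, i \in s & B i w} ->
  pr A <= \sum_(i <- s) pr (B i).
Proof.
move=> mA mB AB; rewrite -lee_fin -integral_sum_indic// fineK ?fin_num_measure//.
rewrite -[P A]mul1e -[A in P A]setIT -integral_indic// mul1e -[leRHS]mul1e.
apply: ae_ge0_le_integralZ => //.
- by move=> w _; rewrite lee_fin; apply: sumr_ge0.
- apply: filterS AB => w ABw _; rewrite mul1e lee_fin indicE.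
  case: (boolP (w \in A)) => [|_]; last by apply: sumr_ge0.
  rewrite inE => /ABw[i si Biw].
  rewrite (perm_big _ (perm_to_rem si)) big_cons indicE mem_set//= lerDl.
  by apply: sumr_ge0.
Qed.

End sums_of_indicators.

(** * Pull counts and reward sums as functions of the history *)

Section bandit_history.
Context (R : realType) (d : measure_display) (Omega : measurableType d).
Variables (P : probability Omega R) (K T : nat).
Variables (I : nat -> Omega -> 'I_K) (r : nat -> Omega -> R).
Variables (nu : 'I_K -> probability R R) (policy : nat -> 'I_K -> Omega -> R).
Hypothesis bandit : bandit_interaction P I r T nu policy.

(* history t is convertible to the measurable sets of the g_sigma_algebraType of
   these generators. *)
Definition history_generators t : set (set Omega) :=
  [set A | exists2 i, (1 <= i <= t)%N &
     (exists a, A = I i @^-1` [set a]) \/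
     (exists2 B : set R, measurable B & A = r i @^-1` B)].

Local Notation Om t := (g_sigma_algebraType (history_generators t)).
Local Notation pr A := (fine (P A)).

Lemma history_measurable t : (t <= T)%N -> history I r t `<=` measurable.
Proof.
move=> tT; apply: smallest_sub; first exact: sigma_algebra_measurable.
move=> A [i /andP[i1 it] [[a ->]|[B mB ->]]].
- by apply: (measurable_choice bandit); rewrite i1 (leq_trans it).
- rewrite -[X in measurable X]setTI.
  by apply: (measurable_reward bandit) => //; rewrite i1 (leq_trans it).
Qed.

Lemma history_measurable_fun t (f : Omega -> R) : (t <= T)%N ->
  measurable_fun setT (f : Om t -> R) -> measurable_fun setT f.
Proof. by move=> tT mf _ B mB; apply: (history_measurable tT); exact: mf. Qed.

Lemma history_choice t i a : (1 <= i <= t)%N -> history I r t (I i @^-1` [set a]).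
Proof. by move=> it; apply: sub_sigma_algebra; exists i => //; left; exists a. Qed.

Lemma measurable_fun_choice t i a : (1 <= i <= t)%N ->
  measurable_fun setT ((fun w => (I i w == a)%:R) : Om t -> R).
Proof.
move=> it; have -> : (fun w => (I i w == a)%:R) = \1_(I i @^-1` [set a]) :> (Om t -> R).
  apply/funext => w; rewrite indicE; congr (_%:R).
  by congr nat_of_bool; apply/eqP/idP; rewrite inE.
by apply: measurable_indic; exact: history_choice.
Qed.

Lemma pulls0 a w : pulls I 0 a w = 0%N.
Proof. by rewrite /pulls big_geq. Qed.

Lemma pullsS t a w : pulls I t.+1 a w = (pulls I t a w + (I t.+1 w == a))%N.
Proof. by rewrite /pulls big_nat_recr. Qed.

Lemma pulls_le t a w : (pulls I t a w <= t)%N.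
Proof.
elim: t => [|t IHt]; first by rewrite pulls0.
by rewrite pullsS -addn1 leq_add// leq_b1.
Qed.

(** The induction needs an arbitrary [phi]: a pull in the last round replaces it by its shift. *)
Lemma measurable_fun_pulls t s a (phi : nat -> R) : (s <= t)%N ->
  measurable_fun setT ((fun w => phi (pulls I s a w)) : Om t -> R).
Proof.
elim: s phi => [|s IHs] phi st.
  by (under eq_fun do rewrite pulls0); exact: measurable_cst.
have -> : (fun w => phi (pulls I s.+1 a w)) = (fun w =>
    phi (pulls I s a w) + (I s.+1 w == a)%:R *
      (phi (pulls I s a w).+1 - phi (pulls I s a w))).
  apply/funext => w; rewrite pullsS; case: (I s.+1 w == a).
    by rewrite addn1 mul1r subrKC.
  by rewrite addn0 mul0r addr0.
apply: measurable_funD; first exact: IHs (ltnW st).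
apply: measurable_funM; first by apply: measurable_fun_choice; rewrite st.
apply: measurable_funB; last exact: IHs (ltnW st).
exact: (IHs (fun n => phi n.+1) (ltnW st)).
Qed.

Definition reward_sum t a w := \sum_(1 <= i < t.+1 | I i w == a) r i w.

Lemma reward_sum0 a w : reward_sum 0 a w = 0.
Proof. by rewrite /reward_sum big_geq. Qed.

Lemma reward_sumS t a w :
  reward_sum t.+1 a w = reward_sum t a w + (I t.+1 w == a)%:R * r t.+1 w.
Proof.
rewrite /reward_sum big_mkcond big_nat_recr//= -big_mkcond; congr (_ + _).
by case: (I t.+1 w == a); rewrite ?mul1r ?mul0r.
Qed.

Lemma measurable_fun_reward_sum t s a : (s <= t)%N ->
  measurable_fun setT ((fun w => reward_sum s a w) : Om t -> R).
Proof.
elim: s => [|s IHs] st.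
  by (under eq_fun do rewrite reward_sum0); exact: measurable_cst.
under eq_fun do rewrite reward_sumS.
apply: measurable_funD; first exact: IHs (ltnW st).
apply: measurable_funM; first by apply: measurable_fun_choice; rewrite st.
move=> _ B mB; rewrite setTI; apply: sub_sigma_algebra.
by exists s.+1; rewrite ?st//; right; exists B.
Qed.

Lemma reward_sum_eq0 t a w : pulls I t a w = 0%N -> reward_sum t a w = 0.
Proof.
elim: t => [|t IHt]; first by rewrite reward_sum0.
rewrite pullsS reward_sumS => /eqP; rewrite addn_eq0 => /andP[/eqP /IHt -> /eqP ->].
by rewrite mul0r addr0.
Qed.

Lemma emp_meanE t a w : emp_mean I r t a w = reward_sum t a w / (pulls I t a w)%:R.
Proof. by []. Qed.

(** Fixing the count [k] lets deviations of an adaptively sampled mean be bounded as for [k]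
    independent rewards. *)
Definition mean_event t a k (Q : set R) : set Omega :=
  [set w | pulls I t a w = k /\ Q (emp_mean I r t a w)].

Lemma history_pulls t a (p : pred nat) : history I r t [set w | p (pulls I t a w)].
Proof.
have mp := @measurable_fun_pulls t t a (fun n => (p n)%:R) (leqnn t).
have := mp measurableT [set 1] (measurable_set1 1); rewrite setTI.
congr (history I r t _); apply/seteqP; split => w /=.
  by case: (p _) => // /esym/eqP; rewrite oner_eq0.
by move=> ->.
Qed.

Lemma history_mean_event t a k Q : measurable Q -> history I r t (mean_event t a k Q).
Proof.
move=> mQ.
have mS : measurable_fun setT ((fun w => reward_sum t a w / k%:R) : Om t -> R).
  by apply: measurable_funM => //; exact: measurable_fun_reward_sum.
have -> : mean_event t a k Q =
    [set w | pulls I t a w == k] `&` (fun w => reward_sum t a w / k%:R) @^-1` Q.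
  rewrite /mean_event; apply/seteqP; split => w /=; rewrite emp_meanE.
    by move=> [<-].
  by move=> [/eqP Nk]; rewrite Nk.
apply: (@measurableI _ (Om t)); first exact: (history_pulls a (pred1 k)).
by have := mS measurableT _ mQ; rewrite setTI.
Qed.

Section exponential_martingale.
Variables (a : 'I_K) (k : nat) (lam psi : R).
Hypothesis mgf1 : (\int[nu a]_x (expR (lam * x - psi))%:E = 1)%E.

Let W t w := expR (lam * reward_sum t a w - psi * (pulls I t a w)%:R).

Let mW t s : (s <= t)%N -> measurable_fun setT (W s : Om t -> R).
Proof.
move=> st; apply: measurableT_comp => //; apply: measurable_funB.
  by apply: measurable_funM => //; exact: measurable_fun_reward_sum.
apply: measurable_funM => //.
exact: (measurable_fun_pulls a (fun n => n%:R)).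
Qed.

Let WS t w : W t.+1 w = W t w *
  (if I t.+1 w == a then expR (lam * r t.+1 w - psi) else 1).
Proof.
rewrite /W reward_sumS pullsS; case: (I t.+1 w == a).
  by rewrite -expRD addn1 -natr1 mul1r; congr expR; ring.
by rewrite addn0 mul0r addr0 mulr1.
Qed.

(* W stopped when a is about to be pulled for the (k+1)-st time: its mean stays 1, and
   the stopped values bound the sum over all rounds of the deviation events. *)
Let Z t w := W t w * (pulls I t a w <= k)%N%:R +
  \sum_(1 <= s < t.+1) (I s w == a)%:R * ((pulls I s.-1 a w == k)%:R * W s.-1 w).

Let Z_ge0 t w : 0 <= Z t w.
Proof.
rewrite addr_ge0// ?mulr_ge0 ?expR_ge0//; apply: sumr_ge0 => s _.
by rewrite !mulr_ge0 ?expR_ge0.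
Qed.

Let mZ t : measurable_fun setT (Z t : Om t -> R).
Proof.
apply: measurable_funD.
  apply: measurable_funM; first exact: mW.
  exact: (measurable_fun_pulls a (fun n => (n <= k)%N%:R)).
suff H n : (n <= t)%N -> measurable_fun setT ((fun w => \sum_(1 <= s < n.+1)
    (I s w == a)%:R * ((pulls I s.-1 a w == k)%:R * W s.-1 w)) : Om t -> R).
  exact: H.
elim: n => [|n IHn] nt.
  by (under eq_fun do rewrite big_geq//); exact: measurable_cst.
under eq_fun do rewrite big_nat_recr//=.
apply: measurable_funD; first exact: IHn (ltnW nt).
apply: measurable_funM; first by apply: measurable_fun_choice; rewrite nt.
apply: measurable_funM; last exact: mW (ltnW nt).
exact: (measurable_fun_pulls a (fun n => (n == k)%:R) (ltnW nt)).
Qed.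

Let B t w := W t w * (pulls I t a w < k)%N%:R.

Let B_ge0 t w : 0 <= B t w. Proof. by rewrite mulr_ge0 ?expR_ge0. Qed.

Let mB t : measurable_fun setT (B t : Om t -> R).
Proof.
apply: measurable_funM; first exact: mW.
exact: (measurable_fun_pulls a (fun n => (n < k)%N%:R)).
Qed.

(** Only a pull of [a] at a count below [k] changes [Z]; at count [k], the value moves from the
    first summand to the sum. Both sides are nonnegative, so they can be integrated without
    subtraction. *)
Let ZS t w : Z t.+1 w + B t w * \1_(I t.+1 @^-1` [set a]) w =
  Z t w + B t w * (\1_(I t.+1 @^-1` [set a]) w * expR (lam * r t.+1 w - psi)).
Proof.
have -> : \1_(I t.+1 @^-1` [set a]) w = (I t.+1 w == a)%:R :> R.
  by rewrite indicE; congr (_%:R); congr nat_of_bool; apply/idP/eqP; rewrite inE.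
rewrite /Z big_nat_recr//= WS pullsS /B; case: (I t.+1 w == a) => /=.
  by rewrite addn1; case: (ltngtP (pulls I t a w) k) => _;
    rewrite /= ?mulr0n ?mulr1n; ring.
by rewrite addn0 !mul0r !mulr0 mulr1; ring.
Qed.

(** The two [B] terms of [ZS] have equal integrals because the new reward is independent of the past
    and has normalized exponential moment 1. That integral is at most the one of [Z t], hence
    finite, and cancels. *)
Lemma exponential_martingale_mean1 t : (t <= T)%N -> (\int[P]_w (Z t w)%:E = 1)%E.
Proof.
elim: t => [|t IHt] tT.
  under eq_integral do rewrite /Z big_geq// addr0 pulls0 leq0n mulr1 /W
    reward_sum0 pulls0 !mulr0 subrr expR0.
  exact: integral_cst_probability.
have tT' := ltnW tT; have {}IHt := IHt tT'.
pose E := I t.+1 @^-1` [set a].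
have mE : measurable E by apply: (measurable_choice bandit); rewrite tT.
have mr : measurable_fun setT (r t.+1) by apply: (measurable_reward bandit); rewrite tT.
have mBO := history_measurable_fun tT' (mB (t := t)).
have mZO := history_measurable_fun tT' (mZ (t := t)).
have mZO' := history_measurable_fun tT (mZ (t := t.+1)).
have mi : measurable_fun setT (\1_E : Omega -> R) by exact: measurable_indic.
have mg : measurable_fun setT (fun x : R => expR (lam * x - psi)).
  by apply: measurableT_comp => //; exact: measurable_funB.
have mgr : measurable_fun setT (fun w => expR (lam * r t.+1 w - psi)).
  exact: (measurableT_comp mg mr).
have i0 w : 0 <= \1_E w :> R by rewrite indicE.
have key : (\int[P]_w (B t w * (\1_E w * expR (lam * r t.+1 w - psi)))%:E =
    \int[P]_w (B t w * \1_E w)%:E)%E.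
  apply: (@integral_reward_factor _ _ _ P (history_generators t) E (r t.+1) (nu a)
    (history_measurable tT') mE mr _ (B t) (fun x => expR (lam * x - psi))) => //.
  move=> A C hA mC; exact: (reward_law bandit).
have B_le : (\int[P]_w (B t w * \1_E w)%:E <= 1)%E.
  rewrite -IHt; apply: ge0_le_integral => //.
  - by move=> w _; rewrite lee_fin mulr_ge0.
  - by apply/measurable_EFinP; exact: measurable_funM.
  - exact/measurable_EFinP.
  - move=> w _; rewrite lee_fin /Z -[leLHS]addr0 lerD//.
      rewrite /B -mulrA ler_wpM2l ?expR_ge0//.
      rewrite (@le_trans _ _ (pulls I t a w < k)%N%:R)//.
        by rewrite ler_piMr// indicE ler_nat leq_b1.
      by rewrite ler_nat; case: ltngtP.
    by apply: sumr_ge0 => s _; rewrite !mulr_ge0 ?expR_ge0.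
have mB1 : measurable_fun setT (fun w => (B t w * \1_E w)%:E).
  by apply/measurable_EFinP; exact: measurable_funM.
have mBe : measurable_fun setT
    (fun w => (B t w * (\1_E w * expR (lam * r t.+1 w - psi)))%:E).
  by apply/measurable_EFinP; do 2 apply: measurable_funM => //.
have mZt : measurable_fun setT (fun w => (Z t w)%:E) by exact/measurable_EFinP.
have mZt1 : measurable_fun setT (fun w => (Z t.+1 w)%:E) by exact/measurable_EFinP.
have : (\int[P]_w (Z t.+1 w)%:E + \int[P]_w (B t w * \1_E w)%:E =
    \int[P]_w (Z t w)%:E +
    \int[P]_w (B t w * (\1_E w * expR (lam * r t.+1 w - psi)))%:E)%E.
  have Z0 s w : setT w -> (0 <= (Z s w)%:E)%E by rewrite lee_fin.
  have B10 w : setT w -> (0 <= (B t w * \1_E w)%:E)%E by rewrite lee_fin mulr_ge0.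
  have Be0 w : setT w ->
      (0 <= (B t w * (\1_E w * expR (lam * r t.+1 w - psi)))%:E)%E.
    by rewrite lee_fin !mulr_ge0 ?expR_ge0.
  rewrite -(ge0_integralD P measurableT (Z0 t.+1) mZt1 B10 mB1).
  rewrite -(ge0_integralD P measurableT (Z0 t) mZt Be0 mBe).
  by apply: eq_integral => w _; rewrite -!EFinD ZS.
rewrite key IHt.
have yfin : (\int[P]_w (B t w * \1_E w)%:E)%E \is a fin_num.
  rewrite ge0_fin_numE; first exact: le_lt_trans B_le (ltry _).
  by apply: integral_ge0 => w _; rewrite lee_fin mulr_ge0.
move=> /(congr1 (fun z => z - \int[P]_w (B t w * \1_E w)%:E)%E).
by rewrite !addeK.
Qed.

Let integral_le_martingale t (Y : Omega -> R) : (t <= T)%N ->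
  measurable_fun setT Y -> (forall w, 0 <= Y w <= Z t w) ->
  (\int[P]_w (Y w)%:E <= 1)%E.
Proof.
move=> tT mY YZ; rewrite -(exponential_martingale_mean1 tT).
apply: ge0_le_integral => //.
- by move=> w _; rewrite lee_fin; case/andP: (YZ w).
- exact/measurable_EFinP.
- by apply/measurable_EFinP; exact: (history_measurable_fun tT (mZ (t := t))).
- by move=> w _; rewrite lee_fin; case/andP: (YZ w).
Qed.

Variables (c : R) (Q : set R).
Hypothesis mQ : measurable Q.
Hypothesis Q_dev : forall z, Q z -> c <= k%:R * (lam * z - psi).

Let W_ge t w : mean_event t a k Q w -> expR c <= W t w.
Proof.
move=> [Nk /Q_dev]; rewrite emp_meanE /W Nk ler_expR.
rewrite (_ : k%:R * _ = lam * reward_sum t a w - psi * k%:R)//.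
have [k0|k0] := eqVneq k 0%N; last by field; rewrite pnatr_eq0.
by rewrite reward_sum_eq0 ?Nk// k0; ring.
Qed.

(** Markov's inequality for [Z]. *)
Let sum_pr_le t (s : seq nat) (A : nat -> set Omega) : (t <= T)%N ->
  (forall i, i \in s -> measurable (A i)) ->
  (forall w, expR c * (\sum_(i <- s) \1_(A i) w) <= Z t w) ->
  \sum_(i <- s) pr (A i) <= expR (- c).
Proof.
move=> tT mA AZ; have mS := measurable_sum_indic mA.
have S0 w : 0 <= \sum_(i <- s) \1_(A i) w :> R by apply: sumr_ge0.
have : (\int[P]_w (expR c * (\sum_(i <- s) \1_(A i) w))%:E <= 1)%E.
  apply: (integral_le_martingale tT); first exact: measurable_funM.
  by move=> w; rewrite AZ mulr_ge0 ?expR_ge0.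
under eq_integral do rewrite EFinM.
rewrite ge0_integralZl_EFin//; last 2 first.
- by move=> w _; rewrite lee_fin.
- exact/measurable_EFinP.
by rewrite integral_sum_indic// -EFinM lee_fin expRN -ler_pdivlMl ?expR_gt0// mulr1.
Qed.

(** At count [k] the first summand of [Z] is still present and equals [W]. *)
Lemma mean_event_pr t : (t <= T)%N -> pr (mean_event t a k Q) <= expR (- c).
Proof.
move=> tT; have := @sum_pr_le t [:: 0%N] (fun=> mean_event t a k Q) tT.
rewrite big_seq1; apply.
  by move=> _ _; apply: (history_measurable tT); exact: history_mean_event.
move=> w; rewrite big_seq1 indicE /Z -[leLHS]addr0 lerD//; last first.
  by apply: sumr_ge0 => s _; rewrite !mulr_ge0 ?expR_ge0.
case: (boolP (w \in _)) => [|_]; last by rewrite mulr0 mulr_ge0 ?expR_ge0.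
by rewrite inE => Aw; have [-> _] := Aw; rewrite leqnn !mulr1 W_ge.
Qed.

(** The pull of [a] made at count [k] occurs in at most one round and is recorded in the second
    summand of [Z], so summing over all rounds costs no factor [t]. *)
Lemma sum_mean_event_pr t : (t <= T)%N ->
  \sum_(1 <= s < t.+1) pr (mean_event s.-1 a k Q `&` I s @^-1` [set a]) <= expR (- c).
Proof.
move=> tT; apply: (sum_pr_le tT).
  move=> s; rewrite mem_index_iota => /andP[s1 st].
  apply: measurableI; last first.
    by apply: (measurable_choice bandit); rewrite s1 (leq_trans _ tT).
  apply: (@history_measurable s.-1); last exact: history_mean_event.
  by rewrite (leq_trans (leq_pred _)) ?(leq_trans _ tT).
move=> w; rewrite /Z -[leLHS]add0r lerD ?mulr_ge0 ?expR_ge0//.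
rewrite mulr_sumr; apply: ler_sum => s _; rewrite indicE.
case: (boolP (w \in _)) => [|_]; last by rewrite mulr0 !mulr_ge0 ?expR_ge0.
rewrite inE => -[Aw Is]; have [-> _] := Aw; have -> : I s w == a by apply/eqP.
by rewrite eqxx !mul1r mulr1; exact: W_ge.
Qed.

End exponential_martingale.
End bandit_history.

(** * Regret of KL-Maillard sampling *)

Lemma exists_nat_ge (R : realType) (x : R) : 0 <= x ->
  exists n : nat, x <= n%:R <= x + 1.
Proof.
move=> x0; exists (Num.truncn x).+1; rewrite ltW ?truncnS_gt//= -natr1 lerD2r.
by rewrite truncn_le.
Qed.

(** Telescoping: [delta * exp (- k delta)] is at most [exp (- (k - 1) delta) - exp (- k delta)]. *)
Lemma sum_expR_le_inv (R : realType) (delta : R) n : 0 < delta ->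
  \sum_(1 <= k < n.+1) expR (- (k%:R * delta)) <= delta^-1.
Proof.
move=> d0; suff : delta * \sum_(1 <= k < n.+1) expR (- (k%:R * delta)) <=
    1 - expR (- (n%:R * delta)).
  move=> h; rewrite -(ler_pM2l d0) mulfV ?gt_eqF//; apply: (le_trans h).
  by rewrite gerBl expR_ge0.
elim: n => [|n IHn]; first by rewrite big_geq// mulr0 mul0r oppr0 expR0 subrr.
rewrite big_nat_recr//= mulrDr.
have E : expR (- (n%:R * delta)) = expR (- (n.+1%:R * delta)) * expR delta.
  by rewrite -expRD -natr1; congr expR; ring.
have := expR_subr1_ge delta; have := expR_gt0 (- (n.+1%:R * delta)).
move: IHn; rewrite E; nra.
Qed.

(** The 64 comes from the divergence bound [g ^+ 2 / (64 * v)] at gap [g], the other factor from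
    collecting the terms of order [ln T / delta] in [gap_pulls_le]. *)
Definition gap_constant (R : realType) : R := 64 * (3 + 4 * expR 1).

Lemma max_over_attained (R : realType) (K : nat) (f : 'I_K -> R) : (0 < K)%N ->
  exists a, max_over f = f a /\ forall c, f c <= f a.
Proof.
case: K f => // K f _; pose a := [arg max_(i > ord0) f i]%O.
have fa c : f c <= f a by rewrite /a; case: arg_maxP => // i _ /(_ c isT).
exists a; split=> //; apply: le_anti; apply/andP; split.
- by apply: ge_sup; [exists (f a); exists a|move=> _ [c _ <-]].
- by apply: sup_ubound; [exists (f a) => _ [c _ <-]|exists a].
Qed.

(** The Chernoff exponent at the observed mean [z] is at least the divergence once [z] is beyond
    [f1 s], on the side of [s] away from [t]. *)
Lemma bregman_tilt (R : realType) (b f1 : R -> R) (s t z : R) :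
  (s - t) * z - (b s - b t) = (s - t) * (z - f1 s) + bregman b f1 s t.
Proof. by rewrite /bregman; ring. Qed.

Section KL_Maillard_sampling.
Context (R : realType) (m : {measure set R -> \bar R}) (Theta : interval R).
Hypothesis partition_fin : forall theta, theta \in Theta ->
  (0 < partition_function m theta < +oo)%E.
Local Notation b := (log_partition m).
Variables (f1 f2 : R -> R).
Hypothesis bD : forall x, x \in Theta -> derivative_in [set` Theta] b x (f1 x).
Hypothesis f1D : forall x, x \in Theta -> derivative_in [set` Theta] f1 x (f2 x).
Hypothesis f2_gt0 : forall x, x \in Theta -> 0 < f2 x.
Hypothesis Theta_nondegenerate : exists s t, [/\ s \in Theta, t \in Theta & s != t].
Context (d : measure_display) (Omega : measurableType d).
Variables (P : probability Omega R) (K T : nat).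
Variables (I : nat -> Omega -> 'I_K) (r : nat -> Omega -> R).
Variable nu : 'I_K -> probability R R.
Local Notation policy := (KL_MS_policy I r m Theta (fun k => k%:R)).
Hypothesis bandit : bandit_interaction P I r T nu policy.
Hypothesis emp_in : emp_means_in P I r T (mean_space m Theta).
Variable th : 'I_K -> R.
Hypothesis thT : forall a, th a \in Theta.
Hypothesis thE : forall a, member_at m (th a) (nu a).

Local Notation D := (bregman b f1).
Local Notation pr A := (fine (P A)).
Local Notation ev := (mean_event I r).
Local Notation chosen t a := (I t @^-1` [set a]).

Let le_f1 := le_derivative1 f1D f2_gt0.
Let D_ge0 := bregman_ge0 bD f1D f2_gt0.
Let D_add := bregman_superadditive b f1D f2_gt0.

Lemma tilted_deviation a s k (Q : set R) t : s \in Theta -> measurable Q ->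
  (forall z, Q z -> 0 <= (s - th a) * (z - f1 s)) -> (t <= T)%N ->
  pr (ev t a k Q) <= expR (- (k%:R * D s (th a))) /\
  \sum_(1 <= i < t.+1) pr (ev i.-1 a k Q `&` chosen i a) <=
    expR (- (k%:R * D s (th a))).
Proof.
move=> sT mQ Qdev tT; have mgf := member_at_mgf partition_fin sT (thT a) (thE a).
have dev z : Q z -> k%:R * D s (th a) <= k%:R * ((s - th a) * z - (b s - b (th a))).
  move=> /Qdev h; rewrite ler_wpM2l//.
  by rewrite (bregman_tilt _ f1) lerDr.
split; first exact: (mean_event_pr bandit mgf mQ dev tT).
exact: (sum_mean_event_pr bandit mgf mQ dev tT).
Qed.

(** Means at or below that of [o] with divergence to [o] at least [c]. The parameter is existential
    because a real number need not be the mean of a member. *)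
Definition level o c : set R :=
  [set z | exists s, [/\ s \in Theta, s <= th o, f1 s = z & c <= D s (th o)]].

(** It is an interval: between two of its points lies the mean of a parameter [p], and the
    divergence to [th o] decreases as the parameter rises towards [th o]. *)
Lemma measurable_level o c : measurable (level o c).
Proof.
apply: is_interval_measurable => _ _ [s1 [s1T s1o <- cs1]] [s2 [s2T s2o <- cs2]].
move=> z /andP[s1z zs2]; have s12 : s1 <= s2.
  by rewrite -(le_f1 s1T s2T) (le_trans s1z zs2).
have [|p /andP[s1p ps2] pz] := IVT_derivative1 f1D (z := z) s1T s2T s12.
  by rewrite s1z.
have pT : p \in Theta.
  by apply: (@interval_is_interval _ Theta s1 s2 s1T s2T); rewrite s1p.
exists p; split=> //; first exact: le_trans s2o.
apply: (le_trans cs2); apply: le_trans (D_add pT (thT o) ps2 s2o).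
by rewrite lerDr D_ge0.
Qed.

(** If the set is nonempty, some [p] has divergence exactly [c] and every point of the set is at
    most [f1 p]; tilting to [p] gives the bound. *)
Lemma level_deviation o c k t : 0 <= c -> (t <= T)%N ->
  pr (ev t o k (level o c)) <= expR (- (k%:R * c)) /\
  \sum_(1 <= i < t.+1) pr (ev i.-1 o k (level o c) `&` chosen i o) <=
    expR (- (k%:R * c)).
Proof.
move=> c0 tT; have [[z [s [sT so _ cs]]]|noz] := pselect (level o c !=set0).
  have [|p /andP[sp po] pc] := bregman_level bD f1D (c := c) sT (thT o) so.
    by rewrite c0.
  have pT : p \in Theta.
    by apply: (@interval_is_interval _ Theta s (th o) sT (thT o)); rewrite sp.
  rewrite -pc; apply: tilted_deviation => //; first exact: measurable_level.
  move=> _ [s' [s'T s'o <- cs']]; rewrite -mulrNN mulr_ge0// oppr_ge0 subr_le0//.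
  rewrite (le_f1 s'T pT).
  exact: (bregman_sublevel bD f1D f2_gt0 s'T pT (thT o) s'o po cs').
have ev0 i : ev i o k (level o c) = set0.
  by rewrite -subset0 => w [_ h]; apply: noz; eexists; exact: h.
split; first by rewrite ev0 measure0 expR_ge0.
by rewrite big1 ?expR_ge0// => i _; rewrite ev0 set0I measure0.
Qed.

Lemma measurable_ev t a k (Q : set R) : (t <= T)%N ->
  measurable Q -> measurable (ev t a k Q).
Proof.
by move=> tT mQ; apply: (history_measurable bandit tT); exact: history_mean_event.
Qed.

Lemma measurable_choice_event t a : (1 <= t <= T)%N -> measurable (chosen t a).
Proof. exact: (measurable_choice bandit). Qed.

Let policy_ge0 t a w : 0 <= policy t a w.
Proof.
rewrite /KL_MS_policy; case: ifP => // _.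
by rewrite divr_ge0 ?expR_ge0// sumr_ge0// => c _; exact: expR_ge0.
Qed.

Lemma choice_le_const t a A c : (1 <= t <= T)%N -> history I r t.-1 A -> 0 < c ->
  {ae P, forall w, A w -> policy t a w <= c} -> pr (A `&` chosen t a) <= c.
Proof.
move=> tT hA c0 Ac; have tT1 : (t.-1 <= T)%N.
  by case/andP: tT => _; exact: leq_trans (leq_pred _).
have mA : measurable A := history_measurable bandit tT1 hA.
rewrite -lee_fin fineK; last first.
  rewrite fin_num_measure//; apply: measurableI => //.
  exact: measurable_choice_event.
rewrite (choice_law bandit)//.
apply: (@le_trans _ _ (c%:E * \int[P]_(w in A) cst 1%E w)%E).
  apply: ae_ge0_le_integralZ => //.
  - by move=> w _; rewrite lee_fin.
  - by apply: filterS Ac => w Acw Aw; rewrite mule1 lee_fin Acw.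
rewrite integral_cst// mul1e -[leRHS]mule1 lee_wpmul2l ?lee_fin ?(ltW c0)//.
exact: probability_le1.
Qed.

(** A ratio of sampling probabilities bounded on a past event lets pulls of [a] be charged to pulls
    of [o]. *)
Lemma choice_le_choice t a o A c : (1 <= t <= T)%N -> history I r t.-1 A -> 0 < c ->
  {ae P, forall w, A w -> policy t a w <= c * policy t o w} ->
  pr (A `&` chosen t a) <= c * pr (A `&` chosen t o).
Proof.
move=> tT hA c0 Ac; have tT1 : (t.-1 <= T)%N.
  by case/andP: tT => _; exact: leq_trans (leq_pred _).
have mA : measurable A := history_measurable bandit tT1 hA.
have fin e : P (A `&` chosen t e) \is a fin_num.
  rewrite fin_num_measure//; apply: measurableI => //.
  exact: measurable_choice_event.
rewrite -lee_fin EFinM !fineK// !(choice_law bandit)//.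
apply: ae_ge0_le_integralZ => //.
- by move=> w _; rewrite lee_fin.
- by move=> w _; rewrite lee_fin.
Qed.

Lemma first_rounds t a : (1 <= t <= T)%N -> (t <= K)%N ->
  pr (chosen t a) = (t == a.+1)%:R.
Proof.
move=> tT tK; rewrite -[chosen t a]setTI (choice_law bandit)//; last first.
  exact: (@measurableT _ (g_sigma_algebraType (history_generators I r t.-1))).
under eq_integral do rewrite /KL_MS_policy tK.
by rewrite integral_cst_probability/= eq_sym.
Qed.

Lemma pulls_gt0 n i a w : (1 <= i <= n)%N -> I i w = a -> (0 < pulls I n a w)%N.
Proof.
move=> + Iia; elim: n => [/andP[i1 /(leq_trans i1)]//|n IHn /andP[i1]].
rewrite leq_eqVlt pullsS => /orP[/eqP <-|]; first by rewrite Iia eqxx addn1.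
by rewrite ltnS => it; rewrite ltn_addr// IHn// i1.
Qed.

(** The first [K] rounds almost surely pull every arm once, so all counts are positive from then
    on. *)
Lemma ae_emp_mean_in n : (K <= n <= T)%N -> (0 < n)%N ->
  {ae P, forall w a, (0 < pulls I n a w)%N /\ mean_space m Theta (emp_mean I r n a w)}.
Proof.
move=> /andP[Kn nT] n0.
apply: filter_forall => a.
have aT : (1 <= a.+1 <= T)%N by rewrite /= (leq_trans (ltn_ord a))// (leq_trans Kn).
have Ia : {ae P, forall w, I a.+1 w = a}.
  exists (~` (chosen a.+1 a)); split=> //.
    exact/measurableC/measurable_choice_event.
  have mI := measurable_choice_event a aT.
  rewrite probability_setC//= -[P (chosen _ _)]fineK ?fin_num_measure//.
  by rewrite first_rounds// eqxx subee.
have n1T : (1 <= n <= T)%N by rewrite n0.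
move: Ia (emp_in a n1T); apply: filterS2 => w Iaw emp.
have N0 : (0 < pulls I n a w)%N.
  by apply: (pulls_gt0 _ Iaw); rewrite /= (leq_trans (ltn_ord a)).
by split=> //; exact: emp.
Qed.

(** The empirically best arm [e] has weight 1, so the normalizer is at least 1, which gives the
    first bound. The second follows from a weight of [c] at most 1, after cancelling the
    normalizer. *)
Lemma policy_bounds t w : (K < t)%N ->
  (forall a, mean_space m Theta (emp_mean I r t.-1 a w)) ->
  exists (s : 'I_K -> R) (e : 'I_K),
  [/\ forall c, s c \in Theta, forall c, f1 (s c) = emp_mean I r t.-1 c w,
      forall c, s c <= s e,
      forall c, policy t c w <= expR (- ((pulls I t.-1 c w)%:R * D (s c) (s e))) &
      forall c o, policy t c w <=
        expR ((pulls I t.-1 o w)%:R * D (s o) (s e)) * policy t o w].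
Proof.
move=> Kt emp.
have /choice[s sE] : forall a, exists x, x \in Theta /\ f1 x = emp_mean I r t.-1 a w.
  move=> a; have /(mean_spaceP partition_fin bD Theta_nondegenerate)[x xT xE] := emp a.
  by exists x.
have sT c : s c \in Theta by case: (sE c).
have s1 c : f1 (s c) = emp_mean I r t.-1 c w by case: (sE c).
have K0 : (0 < K)%N by apply: leq_trans (ltn_ord (I 0 w)).
have [e [maxE maxP]] := max_over_attained (fun a => emp_mean I r t.-1 a w) K0.
have se c : s c <= s e by rewrite -le_f1// !s1.
pose g c := expR (- ((pulls I t.-1 c w)%:R * D (s c) (s e))).
have wE c : KL_MS_weight I r m Theta (fun k => k%:R) t c w = g c.
  rewrite /KL_MS_weight /emp_max maxE -!s1.
  by rewrite (KL_of_means_bregman partition_fin bD f1D f2_gt0 Theta_nondegenerate).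
have g0 c : 0 < g c by exact: expR_gt0.
pose M := \sum_(c < K) g c.
have M1 : 1 <= M.
  rewrite /M (bigD1 e)//= -[leLHS]addr0 lerD//.
    by rewrite /g bregmanxx mulr0 oppr0 expR0.
  by apply: sumr_ge0 => c _; exact: ltW.
have M0 : 0 < M := lt_le_trans ltr01 M1.
have pE c : policy t c w = g c / M.
  rewrite /KL_MS_policy leqNgt Kt/= wE; congr (_ / _).
  by apply: eq_bigr => i _; exact: wE.
exists s, e; split=> //.
- by move=> c; rewrite pE -/(g c) ler_pdivrMr// ler_peMr// ltW.
- move=> c o; rewrite !pE mulrA ler_pM2r ?invr_gt0// /g -expRD subrr expR0.
  rewrite -expR0 ler_expR oppr_le0 mulr_ge0//.
  exact: D_ge0.
Qed.

Let ae_emp_mean_member n : (K <= n <= T)%N -> (0 < n)%N ->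
  {ae P, forall w a, (0 < pulls I n a w)%N /\
    exists2 s, s \in Theta & f1 s = emp_mean I r n a w}.
Proof.
move=> KnT n0; apply: filterS (ae_emp_mean_in KnT n0) => w H a.
have [N0 /(mean_spaceP partition_fin bD Theta_nondegenerate)] := H a.
by split.
Qed.

Let history_emp_mean n a (Q : set R) : measurable Q ->
  history I r n [set w | Q (emp_mean I r n a w)].
Proof.
move=> mQ; have -> : [set w | Q (emp_mean I r n a w)] = \bigcup_k ev n a k Q.
  apply/seteqP; split => w /=; first by move=> Qw; exists (pulls I n a w).
  by move=> [k _ []].
apply: (@bigcupT_measurable _ (g_sigma_algebraType (history_generators I r n))) => k.
exact: history_mean_event.
Qed.

(** * Expected pulls of an arm [a] compared with a better arm [o] *)

Section suboptimal_arm.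
Variables (a o : 'I_K) (sx sy : R) (u J : nat).
Hypotheses (sxT : sx \in Theta) (syT : sy \in Theta).
Hypotheses (sxy : sx <= sy) (syo : sy <= th o).

Let Qx := [set` `[f1 sx, +oo[].

Let high n := [set w | exists c, f1 sy <= emp_mean I r n c w].

Let history_high n : history I r n (high n).
Proof.
have -> : high n = \bigcup_(c in [set: 'I_K])
    [set w | [set` `[f1 sy, +oo[] (emp_mean I r n c w)].
  apply/seteqP; split => w /=.
    by move=> [c cw]; exists c => //=; rewrite in_itv/= cw.
  by move=> [c _ /=]; rewrite in_itv/= andbT => cw; exists c.
apply: (@fin_bigcup_measurable _ (g_sigma_algebraType (history_generators I r n))).
  exact: finite_finset.
by move=> c _; apply: history_emp_mean; exact: measurable_itv.
Qed.

Let low_arm_event n := [set w | (u < pulls I n a w)%N] `&`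
  [set w | [set` `]-oo, f1 sx[] (emp_mean I r n a w)] `&` high n.

Let history_low_arm_event n : history I r n (low_arm_event n).
Proof.
apply: (@measurableI _ (g_sigma_algebraType (history_generators I r n))).
  apply: (@measurableI _ (g_sigma_algebraType (history_generators I r n))).
    exact: (history_pulls a (fun k => (u < k)%N)).
  by apply: history_emp_mean; exact: measurable_itv.
exact: history_high.
Qed.

(** Peeling: [k] times the divergence from the empirical mean to [o] has integer part [j]. *)
Let layer k j := level o (j%:R / k%:R) `\` level o (j.+1%:R / k%:R).

Let layer_event n k j := ev n o k (layer k j) `&` ~` high n.

Let history_layer_event n k j : history I r n (layer_event n k j).
Proof.
apply: (@measurableI _ (g_sigma_algebraType (history_generators I r n))).
  by apply: history_mean_event; apply: measurableD; exact: measurable_level.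
apply: (@measurableC _ (g_sigma_algebraType (history_generators I r n))).
exact: history_high.
Qed.

(** Here the parameters are ordered [s a <= sx <= sy <= s e], so superadditivity bounds the
    divergence in the weight of [a] below by [D sx sy]. *)
Let low_arm_pr t : (K < t <= T)%N ->
  pr (low_arm_event t.-1 `&` chosen t a) <= expR (- (u%:R * D sx sy)).
Proof.
move=> /andP[Kt tT]; have t0 : (0 < t)%N by exact: leq_ltn_trans Kt.
have KtT : (K <= t.-1 <= T)%N by rewrite -ltnS prednK// Kt (leq_trans (leq_pred _)).
have t10 : (0 < t.-1)%N.
  by apply: leq_trans (leq_ltn_trans (leq0n a) (ltn_ord a)) _; case/andP: KtT.
apply: choice_le_const; rewrite ?t0 ?expR_gt0//.
apply: filterS (ae_emp_mean_in KtT t10) => w good [[uN xw] [c yw]].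
have [s [e [sT s1 se pb _]]] := policy_bounds Kt (fun c => (good c).2).
apply: (le_trans (pb a)); rewrite ler_expR lerN2.
have sax : s a <= sx.
  by rewrite -(le_f1 (sT a) sxT) s1 ltW//; move: xw; rewrite /= in_itv.
have sye : sy <= s e.
  by apply: le_trans (se c); rewrite -(le_f1 syT (sT c)) s1.
have h1 := D_add (sT a) (sT e) sax (le_trans sxy sye).
have h2 := D_add sxT (sT e) sxy sye.
have h3 := D_ge0 (sT a) sxT; have h4 := D_ge0 syT (sT e).
have h5 := D_ge0 sxT syT.
apply: (@le_trans _ _ ((pulls I t.-1 a w)%:R * D sx sy)).
  by rewrite ler_wpM2r// ler_nat ltnW.
by rewrite ler_wpM2l//; lra.
Qed.

(** With [s o <= s e <= sy <= th o], superadditivity gives [D (s o) (s e) + D sy (th o) <= D (s o)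
    (th o)], which is below [(j + 1) / k] on the layer. This bounds the ratio of sampling
    probabilities; the layer is then enlarged to [level], whose deviations are summable over
    rounds. *)
Let layer_pr t k j : (K < t <= T)%N -> (0 < k)%N ->
  pr (layer_event t.-1 k j `&` chosen t a) <=
  expR (j.+1%:R - k%:R * D sy (th o)) *
    pr (ev t.-1 o k (level o (j%:R / k%:R)) `&` chosen t o).
Proof.
move=> /andP[Kt tT] k0; have t0 : (0 < t)%N by exact: leq_ltn_trans Kt.
have tT' : (1 <= t <= T)%N by rewrite t0.
have KtT : (K <= t.-1 <= T)%N by rewrite -ltnS prednK// Kt (leq_trans (leq_pred _)).
have t10 : (0 < t.-1)%N.
  by apply: leq_trans (leq_ltn_trans (leq0n a) (ltn_ord a)) _; case/andP: KtT.
have mo := measurable_choice_event o tT'.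
have mlev c := measurable_ev o k (andP KtT).2 (measurable_level o c).
apply: (@le_trans _ _ (expR (j.+1%:R - k%:R * D sy (th o)) *
    pr (layer_event t.-1 k j `&` chosen t o))); last first.
  rewrite ler_wpM2l ?expR_ge0//.
  have ml := history_measurable bandit (andP KtT).2
    (history_layer_event (n := t.-1) k j).
  rewrite fine_le ?fin_num_measure//; [exact: measurableI|exact: measurableI|].
  rewrite le_measure ?inE//; [exact: measurableI|exact: measurableI|].
  by apply: setSI => w [[Nk [lw _]] _].
apply: choice_le_choice; rewrite ?expR_gt0//.
apply: filterS (ae_emp_mean_in KtT t10) => w good [[Nk [_ lw]] nh].
have [s [e [sT s1 se _ pb]]] := policy_bounds Kt (fun c => (good c).2).
apply: (le_trans (pb a o)); rewrite ler_wpM2r ?policy_ge0// ler_expR Nk.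
have sye : s e <= sy.
  rewrite -(le_f1 (sT e) syT) leNgt; apply/negP => ye.
  by apply: nh; exists e; rewrite -s1 ltW.
have Dlt : D (s o) (th o) < j.+1%:R / k%:R.
  rewrite ltNge; apply/negP => h; apply: lw; exists (s o); split=> //.
  exact: le_trans (se o) (le_trans sye syo).
have h1 := D_add (sT o) syT (se o) sye.
have h2 := D_add (sT o) (thT o) (le_trans (se o) sye) syo.
have h3 := D_ge0 (sT e) syT.
have kR : 0 < k%:R :> R by rewrite ltr0n.
have h4 : k%:R * (D (s o) (s e) + D sy (th o)) <= j.+1%:R.
  rewrite -[leRHS](divfK (lt0r_neq0 kR)) mulrC ler_wpM2r ?(ltW kR)//.
  by apply: le_trans (ltW Dlt); lra.
by move: h4; rewrite mulrDr; lra.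
Qed.

(* In this order: the initial pull of a, few pulls of a, over-estimation of a, good
   estimates, o far below its mean (N_o D(o^, o) >= J), and the layers j < J. *)
Lemma round_pr_le t : (1 <= t <= T)%N -> pr (chosen t a) <= (t == a.+1)%:R +
  \sum_(0 <= k < u.+1) pr (ev t.-1 a k setT `&` chosen t a) +
  \sum_(1 <= k < T.+1) pr (ev t.-1 a k Qx `&` chosen t a) +
  expR (- (u%:R * D sx sy)) + \sum_(1 <= k < T.+1) expR (- J%:R) +
  \sum_(1 <= k < T.+1) \sum_(0 <= j < J) expR (j.+1%:R - k%:R * D sy (th o)) *
    pr (ev t.-1 o k (level o (j%:R / k%:R)) `&` chosen t o).
Proof.
move=> tT; have pr0 A : 0 <= pr A by rewrite fine_ge0.
have [tK|Kt] := leqP t K.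
  rewrite first_rounds// -!addrA lerDl.
  do 4 (apply: addr_ge0; first by
    [exact: expR_ge0|apply: sumr_ge0 => k _; rewrite ?pr0 ?expR_ge0]).
  by do 2 (apply: sumr_ge0 => ? _); rewrite mulr_ge0 ?expR_ge0.
have KT : (K < t <= T)%N by rewrite Kt; case/andP: tT.
have t0 : (0 < t)%N by exact: leq_ltn_trans Kt.
have KtT : (K <= t.-1 <= T)%N.
  by rewrite -ltnS prednK// Kt (leq_trans (leq_pred _))//; case/andP: tT.
have t1T := (andP KtT).2.
have t10 : (0 < t.-1)%N.
  by apply: leq_trans (leq_ltn_trans (leq0n a) (ltn_ord a)) _; case/andP: KtT.
have ma := measurable_choice_event a tT.
have inQx z : f1 sx <= z -> Qx z by move=> xz; rewrite /Qx/= in_itv/= xz.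
have in_low z : z < f1 sx -> [set` `]-oo, f1 sx[] z.
  by move=> xz; rewrite /= in_itv/= xz.
pose B1 k := ev t.-1 a k setT `&` chosen t a.
pose B2 k := ev t.-1 a k Qx `&` chosen t a.
pose B3 := low_arm_event t.-1 `&` chosen t a.
pose B4 k := ev t.-1 o k (level o (J%:R / k%:R)).
pose B5 k j := layer_event t.-1 k j `&` chosen t a.
pose s1 := index_iota 0 u.+1; pose s2 := index_iota 1 T.+1; pose s3 := index_iota 0 J.
pose s : seq (set Omega) := map B1 s1 ++ map B2 s2 ++ [:: B3] ++ map B4 s2 ++
  [seq B5 k j | k <- s2, j <- s3].
have : pr (chosen t a) <= \sum_(B <- s) pr B.
  apply: ae_prob_le_sum => //.
    move=> B; rewrite !mem_cat.
    move=> /or4P[/mapP[k _ ->]|/mapP[k _ ->]| |/orP[/mapP[k _ ->]|]].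
    - by apply: measurableI => //; exact: measurable_ev.
    - by apply: measurableI => //; apply: measurable_ev => //; exact: measurable_itv.
    - rewrite inE => /eqP ->; apply: measurableI => //.
      exact: (history_measurable bandit t1T (history_low_arm_event (n := t.-1))).
    - by apply: measurable_ev => //; exact: measurable_level.
    - move=> /allpairsP[[k j] [_ _ ->]]; apply: measurableI => //.
      exact: (history_measurable bandit t1T (history_layer_event (n := t.-1) k j)).
  apply: filterS (ae_emp_mean_member KtT t10) => w good wa.
  have NT c : (pulls I t.-1 c w < T.+1)%N.
    by rewrite ltnS (leq_trans (pulls_le _ _ _ _)).
  have [Nu|uN] := leqP (pulls I t.-1 a w) u.
    exists (B1 (pulls I t.-1 a w)); last by split.
    by rewrite mem_cat map_f// mem_index_iota.
  have [xw|wx] := leP (f1 sx) (emp_mean I r t.-1 a w).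
    exists (B2 (pulls I t.-1 a w)); last by split=> //; split=> //; exact: inQx.
    by rewrite !mem_cat map_f ?orbT// mem_index_iota NT andbT; case: (good a).
  have [hw|nhw] := pselect (high t.-1 w).
    exists B3; first by rewrite !mem_cat mem_seq1 eqxx !orbT.
    by split=> //; split=> //; split=> //; exact: in_low.
  have [No0 [so soT so1]] := good o; have NoT := NT o.
  have NR : 0 < (pulls I t.-1 o w)%:R :> R by rewrite ltr0n.
  have soy : so <= sy.
    rewrite -(le_f1 soT syT) so1 leNgt; apply/negP => h.
    by apply: nhw; exists o; exact: ltW.
  have soo : so <= th o := le_trans soy syo.
  pose Y := D so (th o) * (pulls I t.-1 o w)%:R.
  have Y0 : 0 <= Y by rewrite mulr_ge0// D_ge0.
  have [JY|YJ] := leP J%:R Y.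
    exists (B4 (pulls I t.-1 o w)).
      by rewrite !mem_cat map_f ?orbT// mem_index_iota No0 NoT.
    by split=> //; exists so; split=> //; rewrite ler_pdivrMr.
  exists (B5 (pulls I t.-1 o w) (Num.truncn Y)).
    rewrite !mem_cat; apply/orP; right; apply/orP; right; apply/orP; right.
    apply/orP; right; apply/allpairsP; exists (pulls I t.-1 o w, Num.truncn Y) => /=.
    by rewrite !mem_index_iota No0 NoT /= truncn_lt_nat.
  split=> //; split=> //; split=> //; split.
    by exists so; split=> //; rewrite ler_pdivrMr// truncn_le.
  move=> [s' [s'T s'o]]; rewrite -so1 => s's.
  have -> : s' = so.
    by apply: le_anti; rewrite -(le_f1 s'T soT) -(le_f1 soT s'T) s's lexx.
  by rewrite ler_pdivrMr// leNgt truncnS_gt.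
move=> /le_trans; apply.
rewrite /s !big_cat !big_map big_seq1 big_allpairs_dep/=.
have bnd5 : \sum_(i1 <- s2) \sum_(i2 <- s3) pr (B5 i1 i2) <=
    \sum_(1 <= k < T.+1) \sum_(0 <= j < J) expR (j.+1%:R - k%:R * D sy (th o)) *
      pr (ev t.-1 o k (level o (j%:R / k%:R)) `&` chosen t o).
  rewrite big_seq [leRHS]big_seq; apply: ler_sum => k.
  rewrite mem_index_iota => /andP[k0 _].
  by apply: ler_sum => j _; exact: layer_pr.
have bnd4 : \sum_(j <- s2) pr (B4 j) <= \sum_(1 <= k < T.+1) expR (- J%:R).
  rewrite big_seq [leRHS]big_seq; apply: ler_sum => k.
  rewrite mem_index_iota => /andP[k0 _].
  have c0 : 0 <= J%:R / k%:R :> R by rewrite divr_ge0.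
  have [+ _] := level_deviation o k c0 t1T.
  by rewrite [k%:R * _]mulrC divfK// pnatr_eq0 -lt0n.
have bnd3 := low_arm_pr KT.
have bnd0 : 0 <= (t == a.+1)%:R :> R by [].
move: bnd5 bnd4 bnd3 bnd0; rewrite -/B3 /B1 /B2 -/s1 -/s2.
move: (\sum_(i1 <- s2) _) (\sum_(1 <= k < T.+1) \sum_(_ <= j < _) _).
move: (\sum_(j <- s2) pr (B4 j)) (\sum_(_ <= k < _) expR _).
move: (pr B3) (expR (- (u%:R * _))) (t == a.+1)%:R.
move: (\sum_(_ <- s1) _) (\sum_(_ <- s2) _) => S1 S2 b3 c3 c0 S4 c4 S5 c5.
lra.
Qed.

(** Summed over rounds, the six terms of [round_pr_le] give 1, [u + 1], [1 / delta], 1, 1 and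
    [e J / delta]. In the last one the deviation bound [exp (- j)] cancels [exp (j + 1)] up to [e],
    for each of the [J] layers. *)
Lemma arm_pulls_le (delta : R) : th a <= sx -> (0 < T)%N ->
  0 < delta -> delta <= D sx (th a) -> delta <= D sx sy -> delta <= D sy (th o) ->
  ln (T%:R : R) <= u%:R * delta -> 2 * ln (T%:R : R) <= J%:R ->
  \sum_(1 <= t < T.+1) pr (chosen t a) <=
    4 + u%:R + delta^-1 + expR 1 * J%:R * delta^-1.
Proof.
move=> ax T0 d0 dxa dxy dyo uT JT.
have pr0 A : 0 <= pr A by rewrite fine_ge0.
have TR : 0 < T%:R :> R by rewrite ltr0n.
(* The trivial tilt [s = th a] has exponent 0: at most one round pulls [a] at count [k]. *)
have dev1 k : \sum_(1 <= t < T.+1) pr (ev t.-1 a k setT `&` chosen t a) <= 1.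
  have [|_] := @tilted_deviation a (th a) k setT T (thT a) measurableT _ (leqnn T).
    by move=> z _; rewrite subrr mul0r.
  by rewrite bregmanxx mulr0 oppr0 expR0.
have dev2 k : \sum_(1 <= t < T.+1) pr (ev t.-1 a k Qx `&` chosen t a) <=
    expR (- (k%:R * delta)).
  have [||_ h] := @tilted_deviation a sx k Qx T sxT _ _ (leqnn T).
  - exact: measurable_itv.
  - by move=> z; rewrite /Qx/= in_itv/= andbT => xz; rewrite mulr_ge0// subr_ge0.
  by apply: (le_trans h); rewrite ler_expR lerN2 ler_wpM2l.
have dev5 k j : (0 < k)%N ->
    \sum_(1 <= t < T.+1) expR (j.+1%:R - k%:R * D sy (th o)) *
      pr (ev t.-1 o k (level o (j%:R / k%:R)) `&` chosen t o) <=
    expR 1 * expR (- (k%:R * delta)).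
  move=> k0; rewrite -mulr_sumr.
  have c0 : 0 <= j%:R / k%:R :> R by rewrite divr_ge0.
  have [_ h] := level_deviation o k c0 (leqnn T).
  apply: (le_trans (ler_wpM2l (expR_ge0 _) h)); rewrite -!expRD ler_expR.
  rewrite [k%:R * (_ / _)]mulrC divfK ?pnatr_eq0 -?lt0n//.
  have := ler_wpM2l (ler0n R k) dyo; rewrite -natr1; lra.
apply: (@le_trans _ _ (\sum_(1 <= t < T.+1) ((t == a.+1)%:R +
  \sum_(0 <= k < u.+1) pr (ev t.-1 a k setT `&` chosen t a) +
  \sum_(1 <= k < T.+1) pr (ev t.-1 a k Qx `&` chosen t a) +
  expR (- (u%:R * D sx sy)) + \sum_(1 <= k < T.+1) expR (- J%:R) +
  \sum_(1 <= k < T.+1) \sum_(0 <= j < J) expR (j.+1%:R - k%:R * D sy (th o)) *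
    pr (ev t.-1 o k (level o (j%:R / k%:R)) `&` chosen t o)))).
  rewrite big_seq [leRHS]big_seq; apply: ler_sum => t; rewrite mem_index_iota ltnS.
  exact: round_pr_le.
rewrite !big_split/=.
have b0 : \sum_(1 <= t < T.+1) (t == a.+1)%:R <= 1 :> R.
  rewrite -natr_sum lern1.
  have -> : (\sum_(1 <= t < T.+1) (t == a.+1) =
      count (pred1 a.+1) (index_iota 1 T.+1))%N.
    by rewrite -sum1_count [RHS]big_mkcond; apply: eq_bigr => t _ /=; case: eqP.
  by rewrite count_uniq_mem ?leq_b1// iota_uniq.
have b1 : \sum_(1 <= t < T.+1) \sum_(0 <= k < u.+1)
    pr (ev t.-1 a k setT `&` chosen t a) <= u%:R + 1.
  rewrite exchange_big/=; apply: (@le_trans _ _ (\sum_(0 <= k < u.+1) 1)).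
    by apply: ler_sum => k _; exact: dev1.
  by rewrite sumr_const_nat subn0 natr1.
have b2 : \sum_(1 <= t < T.+1) \sum_(1 <= k < T.+1)
    pr (ev t.-1 a k Qx `&` chosen t a) <= delta^-1.
  rewrite exchange_big/=; apply: le_trans (sum_expR_le_inv T d0).
  by apply: ler_sum => k _; exact: dev2.
have b3 : \sum_(1 <= t < T.+1) expR (- (u%:R * D sx sy)) <= 1.
  rewrite sumr_const_nat subSS subn0 -[_ *+ T]mulr_natr.
  have h : expR (- (u%:R * D sx sy)) <= T%:R^-1.
    rewrite -[T%:R in leRHS]lnK ?posrE// -expRN ler_expR lerN2.
    by apply: (le_trans uT); rewrite ler_wpM2l.
  by apply: (le_trans (ler_wpM2r (ltW TR) h)); rewrite mulVf ?gt_eqF.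
have b4 : \sum_(1 <= t < T.+1) \sum_(1 <= k < T.+1) expR (- J%:R) <= 1 :> R.
  rewrite sumr_const_nat subSS subn0 sumr_const_nat subSS subn0.
  rewrite -[_ *+ T *+ T]mulr_natr -[_ *+ T]mulr_natr -mulrA.
  have h : expR (- J%:R) <= T%:R^-1 * T%:R^-1 :> R.
    rewrite -[T%:R in leRHS]lnK ?posrE// -expRN -expRD ler_expR; lra.
  have TT : 0 <= T%:R * T%:R :> R by rewrite mulr_ge0.
  have := ler_wpM2r TT h.
  rewrite (_ : T%:R^-1 * T%:R^-1 * (T%:R * T%:R) = 1) ?mulrA//.
  by field; rewrite gt_eqF.
have b5 : \sum_(1 <= t < T.+1) \sum_(1 <= k < T.+1) \sum_(0 <= j < J)
    expR (j.+1%:R - k%:R * D sy (th o)) *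
    pr (ev t.-1 o k (level o (j%:R / k%:R)) `&` chosen t o) <=
    expR 1 * J%:R * delta^-1.
  rewrite exchange_big/=.
  apply: (@le_trans _ _ (\sum_(1 <= k < T.+1) expR 1 * J%:R * expR (- (k%:R * delta)))).
    rewrite big_seq [leRHS]big_seq; apply: ler_sum => k.
    rewrite mem_index_iota => /andP[k0 _].
    rewrite exchange_big/=.
    apply: (@le_trans _ _ (\sum_(0 <= j < J) expR 1 * expR (- (k%:R * delta)))).
      by apply: ler_sum => j _; exact: dev5.
    by rewrite sumr_const_nat subn0 -[_ *+ J]mulr_natr mulrAC.
  by rewrite -mulr_sumr ler_wpM2l ?mulr_ge0 ?expR_ge0// sum_expR_le_inv.
lra.
Qed.

End suboptimal_arm.

(** * From the pull bound to the regret bound *)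

Section Lipschitz_variance.
Variables (C_L M : R).
Hypotheses (hC_L : 0 < C_L) (hM : 0 < M) (T2 : (2 <= T)%N).
Hypothesis Lip : forall mu mu', 0 < mu <= M -> 0 < mu' <= M ->
  mean_space m Theta mu -> mean_space m Theta mu' ->
  `|variance_function m Theta mu - variance_function m Theta mu'| <= C_L * `|mu - mu'|.
Hypothesis mean_in : forall a, 0 < f1 (th a) <= M.

Local Notation c1 := (gap_constant R).
Local Notation l := (ln (T%:R : R)).

Let c1_ge0 : 0 <= c1.
Proof.
by rewrite /gap_constant !mulr_ge0// addr_ge0// mulr_ge0// expR_ge0.
Qed.

Let TR : 0 < T%:R :> R. Proof. by rewrite ltr0n (leq_trans _ T2). Qed.

(** Lets additive constants be absorbed into multiples of [ln T]. *)
Let l_ge : 2^-1 <= l.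
Proof.
have := expR_ge1Dx (- l); rewrite expRN lnK ?posrE// => h.
have : T%:R^-1 <= 2^-1 :> R by rewrite lef_pV2 ?posrE// ler_nat.
lra.
Qed.

Let l_gt0 : 0 < l. Proof. by apply: lt_le_trans l_ge; rewrite invr_gt0. Qed.

(** Between two arms all means stay in [(0, M]], where the Lipschitz condition applies. *)
Lemma variance_le_Lipschitz a o x : x \in Theta -> th a <= x <= th o ->
  f2 x <= f2 (th o) + C_L * (f1 (th o) - f1 (th a)).
Proof.
move=> xT /andP[ax xo]; have ax1 : f1 (th a) <= f1 x by rewrite le_f1.
have xo1 : f1 x <= f1 (th o) by rewrite le_f1.
have xin : 0 < f1 x <= M.
  have /andP[a0 _] := mean_in a; have /andP[_ oM] := mean_in o.
  by rewrite (lt_le_trans a0 ax1) (le_trans xo1 oM).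
have sp t : t \in Theta -> mean_space m Theta (f1 t).
  by move=> tT; apply/(mean_spaceP partition_fin bD Theta_nondegenerate); exists t.
have := Lip xin (mean_in o) (sp _ xT) (sp _ (thT o)).
rewrite !(variance_function_mean partition_fin bD f1D f2_gt0 Theta_nondegenerate)//.
move=> h; have := le_trans (ler_norm _) h.
rewrite ler0_norm ?subr_le0// opprB.
have : C_L * (f1 (th o) - f1 x) <= C_L * (f1 (th o) - f1 (th a)).
  by rewrite ler_wpM2l ?(ltW hC_L)// lerB.
lra.
Qed.

Lemma gap_pulls_le a o : f1 (th a) < f1 (th o) ->
  (f1 (th o) - f1 (th a)) * \sum_(1 <= t < T.+1) pr (chosen t a) <=
  (10 * M + c1 * C_L) * l + c1 * f2 (th o) * l / (f1 (th o) - f1 (th a)).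
Proof.
move=> ao; have ato : th a <= th o by rewrite -(le_f1 (thT a) (thT o)) ltW.
set g := f1 (th o) - f1 (th a); have g0 : 0 < g by rewrite subr_gt0.
set v := f2 (th o) + C_L * g.
have v0 : 0 < v by rewrite addr_gt0 ?f2_gt0 ?mulr_gt0.
have [|sx /andP[asx sxo] fsx] :=
    IVT_derivative1 f1D (z := f1 (th a) + g / 4) (thT a) (thT o) ato.
  by rewrite /g in g0 *; lra.
have [|sy /andP[asy syo] fsy] :=
    IVT_derivative1 f1D (z := f1 (th o) - g / 4) (thT a) (thT o) ato.
  by rewrite /g in g0 *; lra.
have inT x : th a <= x -> x <= th o -> x \in Theta.
  move=> ax xo; apply: (@interval_is_interval _ Theta _ _ (thT a) (thT o)).
  by rewrite ax.
have sxT := inT _ asx sxo; have syT := inT _ asy syo.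
have sxy : sx <= sy by rewrite -(le_f1 sxT syT) fsx fsy /g in g0 *; lra.
have lower x y : x \in Theta -> y \in Theta -> th a <= x <= th o -> th a <= y <= th o ->
    (f1 y - f1 x) ^+ 2 <= 4 * v * D x y.
  move=> xT yT /andP[ax xo] /andP[ay yo].
  apply: (bregman_lower_bound bD f1D f2_gt0 xT yT) => z zT.
  rewrite ge_min le_max => /andP[/orP zl /orP zr].
  apply: variance_le_Lipschitz => //; apply/andP; split.
    by case: zl; exact: le_trans.
  by case: zr => /le_trans; apply.
(* The mean differences used below are at least [g / 4]; their squares, at least [g ^+ 2 / 16], are
   divided by the [4 * v] of [bregman_lower_bound]. *)
pose delta := g ^+ 2 / (64 * v).
have d0 : 0 < delta by rewrite divr_gt0 ?exprn_gt0// mulr_gt0.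
have delta_le x y : x \in Theta -> y \in Theta ->
    th a <= x <= th o -> th a <= y <= th o ->
    g ^+ 2 / 16 <= (f1 y - f1 x) ^+ 2 -> delta <= D x y.
  move=> xT yT hx hy hg; rewrite ler_pdivrMr ?mulr_gt0//.
  have := le_trans hg (lower x y xT yT hx hy); lra.
have dxa : delta <= D sx (th a).
  by apply: delta_le; rewrite ?thT ?asx ?sxo ?lexx ?ato// fsx; nra.
have dyo : delta <= D sy (th o).
  by apply: delta_le; rewrite ?thT ?asy ?syo ?lexx ?ato// fsy; nra.
have dxy : delta <= D sx sy.
  apply: delta_le; rewrite ?asx ?sxo ?asy ?syo// fsx fsy.
  rewrite (_ : _ - _ = g / 2); last by rewrite /g; field.
  nra.
have [u /andP[lu ul]] := exists_nat_ge (divr_ge0 (ltW l_gt0) (ltW d0)).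
have l20 : 0 <= 2 * l by rewrite mulr_ge0// ltW.
have [J /andP[lJ Jl]] := exists_nat_ge l20.
rewrite ler_pdivrMr// in lu.
have T0 : (0 < T)%N by exact: leq_trans T2.
have := arm_pulls_le (a := a) sxT syT sxy syo asx T0 d0 dxa dxy dyo lu lJ.
set S := \sum_(1 <= t < T.+1) _ => hS.
have w0 : 0 < delta^-1 by rewrite invr_gt0.
have e0 := expR_gt0 (1 : R).
(* Since [1 <= 2 * l], the constant 5 is at most [10 * l], [1 / delta] at most [2 * l / delta], and
   [J <= 2 * l + 1 <= 4 * l]. *)
have hS' : S <= 10 * l + (3 + 4 * expR 1) * l * delta^-1.
  apply: (le_trans hS); have hJ : J%:R <= 4 * l :> R by have := l_ge; lra.
  have h1 : expR 1 * J%:R * delta^-1 <= expR 1 * (4 * l) * delta^-1.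
    by rewrite ler_pM2r// ler_pM2l.
  have h2 : delta^-1 <= 2 * l * delta^-1.
    by rewrite ler_peMl ?(ltW w0)//; have := l_ge; lra.
  have := l_ge; move: h1 h2 ul; lra.
apply: (le_trans (ler_wpM2l (ltW g0) hS')).
have gM : g <= M.
  have /andP[a0 _] := mean_in a; have /andP[_ oM] := mean_in o.
  by rewrite /g; lra.
(* As [v = f2 (th o) + C_L * g], the quotient [64 * v / g] splits into a variance term of order
   [1 / g] and a term free of [g]. *)
have -> : g * (10 * l + (3 + 4 * expR 1) * l * delta^-1) =
    10 * (g * l) + c1 * C_L * l + c1 * f2 (th o) * l / g.
  rewrite /delta /gap_constant /v; field; rewrite -/v.
  by rewrite !gt_eqF.
have : g * l <= M * l by rewrite ler_pM2r.
lra.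
Qed.

Let sum_chosen t : (1 <= t <= T)%N -> \sum_(a < K) pr (chosen t a) = 1.
Proof.
move=> tT; apply: EFin_inj; rewrite -big_enum -integral_sum_indic; last first.
  by move=> a _; exact: measurable_choice_event.
rewrite -[RHS](integral_cst_probability P 1); apply: eq_integral => w _.
congr EFin; rewrite big_enum/= (bigD1 (I t w))//= indicE mem_set//= big1 ?addr0//.
move=> a aI; rewrite indicE memNset//= => Ia.
by move: aI; rewrite -Ia eqxx.
Qed.

Lemma regretE : regret P I T nu = (\sum_(a < K)
  (max_over (fun a => mean (nu a)) - mean (nu a)) *
    \sum_(1 <= t < T.+1) pr (chosen t a))%:E.
Proof.
rewrite /regret unlock; set mx := max_over _.
have K0 : (0 < K)%N := leq_ltn_trans (leq0n _) (ltn_ord (I 0 point)).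
have gap0 a : 0 <= mx - mean (nu a).
  have [e [maxE maxP]] := max_over_attained (fun a => mean (nu a)) K0.
  by rewrite subr_ge0 /mx maxE.
pose s := [seq (t, a) | t <- index_iota 1 T.+1, a <- enum 'I_K].
have ms (p : nat * 'I_K) : p \in s -> measurable (chosen p.1 p.2).
  move=> /allpairsP[[t a] [+ _ ->]]; rewrite mem_index_iota => tT.
  exact: measurable_choice_event.
have := integral_sum_indicZ P ms (fun p => gap0 p.2).
rewrite [in RHS]/s big_allpairs_dep/= exchange_big/= big_enum/=.
under [in RHS]eq_bigr do rewrite -mulr_sumr.
move=> <-; apply: eq_integral => w _; congr EFin.
rewrite /s big_allpairs_dep/=; apply: eq_bigr => t _.
rewrite big_enum/= (bigD1 (I t w))//= indicE mem_set//= mulr1 big1 ?addr0//.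
move=> a aI; rewrite indicE memNset ?mulr0//= => Ia.
by move: aI; rewrite -Ia eqxx.
Qed.

Lemma regret_le : (regret P I T nu <=
  ((1 + c1 + (10 * M + c1 * C_L)) * Num.sqrt
     (variance_function m Theta (max_over (fun a => mean (nu a))) *
       K%:R * T%:R * ln T%:R)
   + (1 + c1 + (10 * M + c1 * C_L)) * K%:R * ln T%:R)%:E)%E.
Proof.
have K0 : (0 < K)%N := leq_ltn_trans (leq0n _) (ltn_ord (I 0 point)).
have [top [maxE maxP]] := max_over_attained (fun a => mean (nu a)) K0.
have mE a : mean (nu a) = f1 (th a).
  exact: (mean_member_at partition_fin bD Theta_nondegenerate (thT a) (thE a)).
rewrite regretE maxE mE lee_fin.
rewrite (variance_function_mean partition_fin bD f1D f2_gt0 Theta_nondegenerate)//.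
set V := f2 (th top); have V0 : 0 < V by exact: f2_gt0.
have KR : 0 < K%:R :> R by rewrite ltr0n.
set Q := V * K%:R * T%:R * l; have Q0 : 0 < Q by rewrite !mulr_gt0.
set q := Num.sqrt Q; have q0 : 0 < q by rewrite sqrtr_gt0.
have qq : q * q = Q by rewrite -expr2 sqr_sqrtr// ltW.
(* This threshold balances both regimes: gaps below it cost [g0 * T = q] in total, larger ones
   contribute a variance term of at most [c1 * V * l * K / g0 = c1 * q]. *)
pose g0 := q / T%:R; have g00 : 0 < g0 by rewrite divr_gt0.
set A := 10 * M + c1 * C_L.
have A0 : 0 <= A by rewrite addr_ge0 ?mulr_ge0// ltW.
pose S a := \sum_(1 <= t < T.+1) pr (chosen t a).
have S0 a : 0 <= S a by apply: sumr_ge0 => t _; rewrite fine_ge0.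
have arm a : (f1 (th top) - f1 (th a)) * S a <= g0 * S a + A * l + c1 * V * l / g0.
  have r0 : 0 <= c1 * V * l / g0 by rewrite !mulr_ge0 ?invr_ge0// ltW.
  have Al : 0 <= A * l by rewrite mulr_ge0// ltW.
  have [small|large] := leP (f1 (th top) - f1 (th a)) g0.
    have := ler_wpM2r (S0 a) small; lra.
  have gap_gt0 : 0 < f1 (th top) - f1 (th a) := lt_trans g00 large.
  have := @gap_pulls_le a top; rewrite -subr_gt0 => /(_ gap_gt0).
  have : c1 * V * l / (f1 (th top) - f1 (th a)) <= c1 * V * l / g0.
    rewrite ler_wpM2l ?mulr_ge0 ?(ltW V0) ?(ltW l_gt0)//.
    by rewrite lef_pV2 ?posrE// ltW.
  have := mulr_ge0 (ltW g00) (S0 a).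
  rewrite -/A -/V -/(S a); lra.
apply: (@le_trans _ _ (\sum_(a < K) (g0 * S a + A * l + c1 * V * l / g0))).
  by apply: ler_sum => a _; rewrite mE; exact: arm.
rewrite !big_split/= -mulr_sumr !sumr_const !card_ord.
rewrite -[A * l *+ K]mulr_natr -[_ / g0 *+ K]mulr_natr.
have -> : \sum_(a < K) S a = T%:R.
  rewrite /S exchange_big/=; transitivity (\sum_(1 <= t < T.+1) 1 : R).
    by apply: eq_big_nat => t tT; exact: sum_chosen.
  by rewrite sumr_const_nat subSS subn0.
have -> : g0 * T%:R = q by rewrite divfK// gt_eqF.
have -> : c1 * V * l / g0 * K%:R = c1 * q.
  rewrite /g0 (_ : c1 * V * l / (q / T%:R) * K%:R = c1 * (V * K%:R * T%:R * l) / q).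
    by rewrite -/Q -qq; field; rewrite gt_eqF.
  by field; rewrite !gt_eqF.
have h1 : 0 <= A * q by rewrite mulr_ge0// ltW.
have h2 : 0 <= (1 + c1) * (K%:R * l) by rewrite mulr_ge0 ?addr_ge0// mulr_ge0// ltW.
lra.
Qed.

End Lipschitz_variance.
End KL_Maillard_sampling.

Theorem corollary12 (R : realType) (C_L M : R) (hC_L : 0 < C_L) (hM : 0 < M) :
  exists2 C : R, 0 < C &
  forall (m : {measure set R -> \bar R}) (Theta : interval R),
    (forall theta, theta \in Theta -> (0 < partition_function m theta < +oo)%E) ->
    C2_in_with_pos_second_derivative [set` Theta] (log_partition m) ->
    (forall mu mu', 0 < mu <= M -> 0 < mu' <= M ->
       mean_space m Theta mu -> mean_space m Theta mu' ->
       `|variance_function m Theta mu - variance_function m Theta mu'|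
         <= C_L * `|mu - mu'|) ->
  forall (K T : nat), (2 <= K)%N -> (2 <= T)%N ->
  forall (nu : 'I_K -> probability R R),
    (forall a, exp_family_upto m Theta M (nu a)) ->
  forall (d : measure_display) (Omega : measurableType d)
         (P : probability Omega R)
         (I : nat -> Omega -> 'I_K) (r : nat -> Omega -> R),
    bandit_interaction P I r T nu
      (KL_MS_policy I r m Theta (fun k => k%:R)) ->
    emp_means_in P I r T (mean_space m Theta) ->
    let mu_max := max_over (fun a => mean (nu a)) in
    (regret P I T nu <=
      (C * Num.sqrt (variance_function m Theta mu_max * K%:R * T%:R * ln T%:R)
       + C * K%:R * ln T%:R)%:E)%E.
Proof.
pose c1 := gap_constant R; pose C := 1 + c1 + (10 * M + c1 * C_L).
have c1_ge0 : 0 <= c1.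
  by rewrite /c1 /gap_constant !mulr_ge0// addr_ge0// mulr_ge0// expR_ge0.
have C_gt0 : 0 < C.
  have := mulr_ge0 c1_ge0 (ltW hC_L); rewrite /C; lra.
exists C => // m Theta partition_fin [f1 [f2 [bD f1D _ f2_gt0]]] Lip K T _ T2 nu nu_in.
move=> d Omega P I r bandit emp_in /=.
have /choice[th thP] : forall a, exists x, x \in Theta /\ member_at m x (nu a).
  by move=> a; have [[x xT xE] _] := nu_in a; exists x.
(* With equal means the regret vanishes. Otherwise two parameters differ, so [Theta] is not a single
   point, where derivatives within [Theta] would leave [f1] and [f2] undetermined. *)
have [eq_means|/existsNP[a /existsNP[c neq_ac]]] :=
    pselect (forall a c, mean (nu a) = mean (nu c)).
  have K0 : (0 < K)%N := leq_ltn_trans (leq0n _) (ltn_ord (I 0 point)).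
  have [top [maxE _]] := max_over_attained (fun a => mean (nu a)) K0.
  rewrite /regret unlock integral0_eq; last first.
    by move=> w _; rewrite big1// => t _; rewrite maxE (eq_means (I t w) top) subrr.
  rewrite lee_fin addr_ge0// ?mulr_ge0 ?sqrtr_ge0 ?(ltW C_gt0)//.
  by rewrite ln_ge0// ler1n (leq_trans _ T2).
have nondegenerate : exists s t, [/\ s \in Theta, t \in Theta & s != t].
  exists (th a), (th c); split; [exact: (thP a).1|exact: (thP c).1|].
  apply/eqP => ac; apply: neq_ac; rewrite /mean unlock; congr fine.
  apply: eq_measure_integral => A mA _.
  have nuaA := (thP a).2 A mA; rewrite ac in nuaA.
  exact: (etrans nuaA (esym ((thP c).2 A mA))).
have thT a' := (thP a').1; have thE a' := (thP a').2.
apply: (regret_le partition_fin bD f1D f2_gt0 nondegenerate bandit emp_in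
  thT thE hC_L hM T2 Lip).
move=> a'; rewrite -(mean_member_at partition_fin bD nondegenerate (thT a') (thE a')).
by case: (nu_in a').
Qed.
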